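(* Let $k$ be a Hausdorff topological field of characteristic zero. If $G$ is a topologically finitely generated topological group, then its continuous Mal'cev completion $G\widehat{\otimes}k$ is finitely generated as a pro-unipotent group.
   Context: A topological group is topologically finitely generated if it contains a dense subgroup that is algebraically finitely generated. For a pro-unipotent group $U$ over $k$, a subset $S\subset U(k)$ generates $U$ if no proper closed subgroup scheme of $U$ contains $S$ in its set of $k$-points; $U$ is finitely generated if it has a finite generating subset in this sense. A topological field is a field with a topology for which addition, multiplication, additive inversion and multiplicative inversion are continuous. An affine algebraic group over $k$ is unipotent if it has a closed embedding into the group of upper-unitriangular $m\times m$ matrices for some $m$; an affine group scheme over $k$ is pro-unipotent if all its finite-dimensional quotient group schemes are unipotent (equivalently it is an inverse limit of unipotent groups). For $U$ unipotent, $U(k)$ has the topology transported from $\mathrm{Lie}(U)\cong k^r$ (product topology) along the bijection $\exp:\mathrm{Lie}(U)\to U(k)$; for $U=\varprojlim_iU_i$ pro-unipotent, $U(k)=\varprojlim_iU_i(k)$ has the inverse limit topology. For a topological group $G$, the continuous Mal'cev $k$-completion $G\widehat{\otimes}k$ is the pro-unipotent group over $k$ representing the functor $U\mapsto\mathrm{Hom}_{\mathrm{cont}}(G,U(k))$ on pro-unipotent groups over $k$. *)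

(* Defs.v *)
From HB Require Import structures.
From mathcomp Require Import all_boot all_order all_algebra.
From mathcomp Require Import boolp classical_sets functions cardinality.
From mathcomp Require Import topology tvs.

Set Implicit Arguments.
Unset Strict Implicit.
Unset Printing Implicit Defensive.

Import GRing.Theory.

Local Open Scope classical_set_scope.
Local Open Scope ring_scope.

(* Continuity of the inverse is required on k \ {0} only, with its subspace
   topology: MathComp's total inverse has 0^-1 = 0. *)
HB.mixin Record isTopologicalField k & GRing.Field k & Topological k := {
  tfield_mul_continuous : continuous (fun x : k * k => x.1 * x.2);
  tfield_inv_continuous :
    {within [set x : k | x != 0], continuous (fun x : k => x^-1)}
}.

#[short(type="topologicalFieldType")]
HB.structure Definition TopologicalField :=
  {k of GRing.Field k & TopologicalZmodule k & isTopologicalField k}.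

HB.mixin Record isTopologicalGroup G & Group G & Topological G := {
  tgroup_mul_continuous : continuous (fun x : G * G => (x.1 * x.2)%g);
  tgroup_inv_continuous : continuous (fun x : G => (x^-1)%g)
}.

#[short(type="topologicalGroupType")]
HB.structure Definition TopologicalGroup :=
  {G of Group G & Topological G & isTopologicalGroup G}.

Definition is_subgroup (G : groupType) (H : set G) : Prop :=
  [/\ H 1%g, (forall x y, H x -> H y -> H (x * y)%g)
    & (forall x, H x -> H (x^-1)%g)].

Definition subgroup_generated (G : groupType) (S : set G) : set G :=
  smallest (@is_subgroup G) S.

Definition topologically_fg (G : topologicalGroupType) : Prop :=
  exists s : seq G, dense (subgroup_generated [set` s]).

(* A list of pairs s stands for the element \sum_(p <- s) p.1 (x) p.2 of the
   tensor product, and tens_eq is equality in the tensor product, expressed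
   by its universal property. *)
Section Tensors.
Variable k : fieldType.

Definition bilin (A B W : lmodType k) (phi : A -> B -> W) : Prop :=
  (forall a, linear (phi a)) /\ (forall b, linear (phi^~ b)).

Definition tens_eq (A B : lmodType k) (s t : seq (A * B)) : Prop :=
  forall (W : lmodType k) (phi : A -> B -> W), bilin phi ->
    \sum_(p <- s) phi p.1 p.2 = \sum_(p <- t) phi p.1 p.2.

Definition trilin (A B C W : lmodType k) (phi : A -> B -> C -> W) : Prop :=
  [/\ (forall a b, linear (phi a b)),
      (forall a c, linear (fun b => phi a b c))
    & (forall b c, linear (fun a => phi a b c))].

Definition tens_eq3 (A B C : lmodType k) (s t : seq (A * B * C)) : Prop :=
  forall (W : lmodType k) (phi : A -> B -> C -> W), trilin phi ->
    \sum_(p <- s) phi p.1.1 p.1.2 p.2 = \sum_(p <- t) phi p.1.1 p.1.2 p.2.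

End Tensors.

(* An affine group scheme over k, given by its coordinate ring: a commutative
   Hopf algebra. *)
Record affine_group (k : fieldType) := AffineGroup {
  coord :> comAlgType k;
  comul : coord -> seq (coord * coord);
  counit : {lrmorphism coord -> k^o};
  antipode : {linear coord -> coord};
  comul_linear : forall (c : k) (a b : coord),
    tens_eq (comul (c *: a + b))
            ([seq (c *: p.1, p.2) | p <- comul a] ++ comul b);
  comul1 : tens_eq (comul 1) [:: (1, 1)];
  comulM : forall a b : coord,
    tens_eq (comul (a * b))
            [seq (p.1 * q.1, p.2 * q.2) | p <- comul a, q <- comul b];
  comulA : forall a : coord,
    tens_eq3 [seq (q.1, q.2, p.2) | p <- comul a, q <- comul p.1]
             [seq (p.1, q.1, q.2) | p <- comul a, q <- comul p.2];
  counitl : forall a : coord,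
    \sum_(p <- comul a) (counit p.1 : k) *: p.2 = a;
  counitr : forall a : coord,
    \sum_(p <- comul a) (counit p.2 : k) *: p.1 = a;
  antipodel : forall a : coord,
    \sum_(p <- comul a) antipode p.1 * p.2 = (counit a : k) *: 1;
  antipoder : forall a : coord,
    \sum_(p <- comul a) p.1 * antipode p.2 = (counit a : k) *: 1
}.

Definition points (k : fieldType) (U : affine_group k) : Type :=
  {lrmorphism U -> k^o}.

Section Convolution.
Variables (k : fieldType) (U : affine_group k).

Definition conv (f g : U -> k) (a : U) : k :=
  \sum_(p <- comul a) f p.1 * g p.2.

Definition convn (f : U -> k) (n : nat) : U -> k :=
  iter n (conv f) (counit U).

Definition pmul_fun (x y : points U) (a : U) : k^o := conv x y a.

Lemma pmul_bilin (x y : points U) :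
  @bilin k U U k^o (fun a b => (x a : k) * (y b : k)).
Proof.
split=> [a c b b'|b c a a'] /=.
- by rewrite linearP /= mulrDr; congr (_ + _); exact: mulrCA.
- by rewrite linearP /= mulrDl; congr (_ + _); rewrite -mulrA.
Qed.

Fact pmul_fun_linear (x y : points U) : linear (pmul_fun x y).
Proof.
move=> c a b; rewrite /pmul_fun /conv.
rewrite (comul_linear c a b (pmul_bilin x y)) big_cat big_map /=; congr (_ + _).
rewrite scaler_sumr; apply: eq_bigr => p _.
by rewrite linearZ /= -mulrA.
Qed.

Fact pmul_fun_monoid (x y : points U) : monoid_morphism (pmul_fun x y).
Proof.
split; rewrite /pmul_fun /conv.
  by rewrite (comul1 (pmul_bilin x y)) big_seq1 /= !rmorph1 mulr1.
move=> a b; rewrite (comulM a b (pmul_bilin x y)) big_allpairs_dep /= big_distrlr /=.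
apply: eq_bigr => p _; apply: eq_bigr => q _ /=.
by rewrite !rmorphM /= mulrACA.
Qed.

HB.instance Definition _ (x y : points U) :=
  GRing.isLinear.Build k U k^o _ (pmul_fun x y) (pmul_fun_linear x y).
HB.instance Definition _ (x y : points U) :=
  GRing.isMonoidMorphism.Build U k^o (pmul_fun x y) (pmul_fun_monoid x y).

Definition pmul (x y : points U) : points U := pmul_fun x y.

End Convolution.

Record ghom (k : fieldType) (U V : affine_group k) := GHom {
  comorph : {lrmorphism V -> U};
  comorph_comul : forall b : V,
    tens_eq (comul (comorph b))
            [seq (comorph p.1, comorph p.2) | p <- comul b];
  comorph_counit : forall b : V, counit U (comorph b) = counit V b
}.

Definition push (k : fieldType) (U V : affine_group k) (f : ghom U V)
    (x : points U) : points V :=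
  x \o comorph f.

Section GhomComp.
Variables (k : fieldType) (U V W : affine_group k).
Variables (g : ghom V W) (f : ghom U V).

Fact gcomp_comul (c : W) :
  tens_eq (comul (comorph f (comorph g c)))
    [seq (comorph f (comorph g p.1), comorph f (comorph g p.2)) | p <- comul c].
Proof.
move=> X phi [phil phir].
have bphi : bilin (fun a b => phi (comorph f a) (comorph f b)).
  by split=> [a d b b'|b d a a'] /=; rewrite linearP /= ?phil ?phir.
rewrite (comorph_comul f _ (conj phil phir)) big_map.
by rewrite (comorph_comul g _ bphi) !big_map.
Qed.

Fact gcomp_counit (c : W) :
  counit U (comorph f (comorph g c)) = counit W c.
Proof. by rewrite !comorph_counit. Qed.

Definition gcomp : ghom U W :=
  @GHom k U W (comorph f \o comorph g) gcomp_comul gcomp_counit.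

End GhomComp.

Section ProUnipotent.
Variable k : fieldType.

Definition is_subalgebra (A : comAlgType k) (B : set A) : Prop :=
  [/\ B 1, (forall (c : k) a b, B a -> B b -> B (c *: a + b))
    & (forall a b, B a -> B b -> B (a * b))].

Definition generates_algebra (A : comAlgType k) (S : set A) : Prop :=
  smallest (@is_subalgebra A) S = setT.

Definition algebraic (U : affine_group k) : Prop :=
  exists s : seq U, generates_algebra [set` s].

(* A homomorphism from U to the group U_m of upper-unitriangular matrices is a
   matrix a in U_m(O(U)), the comorphism k[x_ij | i < j] -> O(U) being
   x_ij |-> a i j; it is a closed embedding when the comorphism is onto, i.e.
   when the entries of a generate O(U). *)
Definition unitriangular_embedding (U : affine_group k) (m : nat)
    (a : 'M[U]_m) : Prop :=
  [/\ (forall i j : 'I_m, (j <= i)%N -> a i j = (i == j)%:R),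
      (forall i j : 'I_m,
         tens_eq (comul (a i j)) [seq (a i l, a l j) | l <- enum 'I_m]),
      (forall i j : 'I_m, counit U (a i j) = (i == j)%:R)
    & generates_algebra [set b | exists i j, b = a i j]].

Definition unipotent (U : affine_group k) : Prop :=
  algebraic U /\
  exists (m : nat) (a : 'M[U]_m), unitriangular_embedding a.

(* A homomorphism of affine groups over a field is a quotient map
   (faithfully flat) iff its comorphism is injective. *)
Definition quotient_map (U Q : affine_group k) (f : ghom U Q) : Prop :=
  injective (comorph f).

Definition prounipotent (U : affine_group k) : Prop :=
  forall (Q : affine_group k) (f : ghom U Q),
    quotient_map f -> algebraic Q -> unipotent Q.

(* Closed subgroup schemes correspond to Hopf ideals. *)
Definition hopf_ideal (U : affine_group k) (I : set U) : Prop :=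
  [/\ [/\ I 0, (forall a b, I a -> I b -> I (a + b))
        & (forall a b, I b -> I (a * b))],
      (forall a, I a -> exists2 s : seq (U * U),
         tens_eq (comul a) s
         & (forall p, p \in s -> I p.1 \/ I p.2)),
      (forall a, I a -> counit U a = 0)
    & (forall a, I a -> I (antipode U a))].

Definition generates (U : affine_group k) (S : set (points U)) : Prop :=
  forall I : set U, hopf_ideal I ->
    (forall x, S x -> forall a, I a -> x a = 0) ->
    I = [set 0].

Definition prounipotent_fg (U : affine_group k) : Prop :=
  exists2 S : set (points U), finite_set S & generates S.

(* Lie(U) as the space of derivations at the identity. *)
Definition Lie (U : affine_group k) : set (U -> k) :=
  [set D | (forall (c : k) a b, D (c *: a + b) = c * D a + D b) /\
           (forall a b, D (a * b) = counit U a * D b + counit U b * D a)].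

(* x = exp(D): the exponential series for the convolution product of linear
   forms on O(U); on each element of O(U) the series is a finite sum. *)
Definition is_exp (U : affine_group k) (D : U -> k) (x : points U) : Prop :=
  forall a : U, exists N : nat,
    (forall n : nat, (N <= n)%N -> convn D n a = 0) /\
    x a = \sum_(n < N) (n`!%:R)^-1 * convn D n a.

Definition Lie_iso (U : affine_group k) (r : nat)
    (phi : 'rV[k]_r -> U -> k) : Prop :=
  (forall (c : k) v w a, phi (c *: v + w) a = c * phi v a + phi w a) /\
  set_bij setT (Lie (U := U)) phi.

End ProUnipotent.

Definition is_topology (X : Type) (O : set (set X)) : Prop :=
  [/\ O setT, (forall A B, O A -> O B -> O (A `&` B))
    & (forall F : set (set X), F `<=` O -> O (\bigcup_(A in F) A))].

(* For unipotent U: the opens of U(k), transported from k^r along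
   k^r ~ Lie(U) -exp-> U(k). *)
Definition unipotent_open (k : topologicalFieldType) (U : affine_group k)
    (V : set (points U)) : Prop :=
  exists (r : nat) (phi : 'rV[k]_r -> U -> k),
    Lie_iso phi /\
    open [set v : 'rV[k]_r | exists2 x : points U, is_exp (phi v) x & V x].

(* For pro-unipotent U: the inverse limit topology on U(k), over all algebraic
   (hence unipotent) quotients Q of U. *)
Definition prounipotent_open (k : topologicalFieldType) (U : affine_group k) :
    set (set (points U)) :=
  smallest (@is_topology (points U))
    [set V | exists (Q : affine_group k) (f : ghom U Q) (W : set (points Q)),
       [/\ quotient_map f, algebraic Q, unipotent_open W
         & V = push f @^-1` W]].

Record cont_hom (k : topologicalFieldType) (G : topologicalGroupType)
    (U : affine_group k) := ContHom {
  cont_hom_fun :> G -> points U;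
  cont_homM : forall g h : G,
    cont_hom_fun (g * h)%g = pmul (cont_hom_fun g) (cont_hom_fun h);
  cont_hom_continuous : forall V : set (points U),
    prounipotent_open V -> open (cont_hom_fun @^-1` V)
}.

(* M represents U |-> Hom_cont(G, U(k)) on pro-unipotent groups. *)
Definition malcev_completion (k : topologicalFieldType)
    (G : topologicalGroupType) (M : affine_group k) : Prop :=
  prounipotent M /\
  exists Phi : forall U : affine_group k,
      prounipotent U -> ghom M U -> cont_hom G U,
    (forall U (hU : prounipotent U), bijective (Phi U hU)) /\
    (forall U V (hU : prounipotent U) (hV : prounipotent V)
       (f : ghom U V) (h : ghom M U) (g : G),
       Phi V hV (gcomp f h) g = push f (Phi U hU h g)).

(* Main.v *)
(* Let u : G -> M(k) be the universal homomorphism and let I be a Hopf ideal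
   killed by the images of topological generators of G.  Functions on M are
   continuous along u, so by density I is killed by all of u(G), and u lifts to
   h : G -> H(k), where H is the closed subgroup O(M)/I.  Once H is known to be
   pro-unipotent and h continuous, the universal property provides a
   homomorphism j : M -> H whose composite with the inclusion H -> M is the
   identity of M; hence O(M) -> O(M)/I is injective and I = 0.

   Pro-unipotence is handled through conilpotency of the coordinate ring, which
   passes to quotients and to subcoalgebras; here one needs that every function
   on M comes from an algebraic quotient of M (local finiteness), and that a
   conilpotent finitely generated Hopf algebra embeds in some U_m.  Continuity
   is handled through the logarithm: x^t(a) is polynomial in t, its derivative
   at t = 0 is a derivation log x with exp (log x) = x, and exp and log are
   polynomial in coordinates, so the topology of U(k) is the coarsest one that
   makes all functions of O(U) continuous. *)
From HB Require Import structures.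
Require Import Defs.
From mathcomp Require Import all_boot all_order all_algebra.
From mathcomp Require Import generic_quotient ring_quotient.
From mathcomp Require Import boolp classical_sets functions cardinality.
From mathcomp Require Import topology tvs.

Set Implicit Arguments.
Unset Strict Implicit.
Unset Printing Implicit Defensive.

Import GRing.Theory.

Local Open Scope classical_set_scope.
Local Open Scope ring_scope.

(** Density only shows that [I] is killed by [u(G)]; that this image is Zariski dense in [M] is not
    known beforehand, and the splitting by [j] is what supplies it. Tensor products are not objects
    here: equality in A (x) A is tested on bilinear maps out of A. Hence the injectivity of c (x) c
    for an injective c is not formal; a linear retraction of c, obtained from Zorn's lemma, extends
    forms from the source to the target. Local finiteness needs a finitely generated subalgebra
    stable under the antipode. The axioms give only the two convolution identities, so the further
    properties of the antipode are derived on comatrices, by uniqueness of matrix inverses. The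
    topology of [k] is arbitrary, so no limits are available: exponential and logarithm are finite
    sums, cut off by the order of nilpotency. Characteristic zero provides the factorials and makes
    a polynomial determined by its values at the naturals. *)

Section LinearAlgebra.
Variable k : fieldType.
Implicit Types A B W : lmodType k.

Lemma bundle_linear A B (f : A -> B) :
  linear f -> exists g : {linear A -> B}, g =1 f.
Proof.
move=> lf; pose m := GRing.isLinear.Build k A B _ f lf.
by exists (HB.pack_for {linear A -> B} f m).
Qed.

Lemma functionalZ B (f : {linear B -> k^o}) (l : k) x :
  f (l *: x) = l * f x :> k.
Proof. by rewrite linearZ. Qed.

(** A maximal subspace meeting the range of [c] trivially is a complement of that range; [r x] is
    the component of [x] along the range. *)
Lemma linear_retraction A B (c : {linear A -> B}) :
  injective c -> exists r : {linear B -> A}, cancel c r.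
Proof.
move=> injc.
pose lclosed (Z : set B) :=
  forall (l : k) x y, Z x -> Z y -> Z (l *: x + y).
have [|Z [[linZ capZ] maxZ]] := @Zorn_bigcup B
  [set Z | lclosed Z /\ forall a, Z (c a) -> a = 0].
  move=> F FP totF; split=> [l x y [X FX Xx] [Y FY Yy]|a [X FX Xa]]; last first.
    by have [_] := FP X FX; apply.
  have [XY|YX] := totF X Y FX FY.
    by exists Y => //; have [+ _] := FP Y FY; apply=> //; exact: XY.
  by exists X => //; have [+ _] := FP X FX; apply=> //; exact: YX.
(* The union of an empty chain is empty, so the sets given to Zorn's lemma could not be required to
   contain 0; it is added here. *)
pose Z0 := [set z | z = 0 \/ Z z].
have linZ0 : lclosed Z0.
  move=> l x y [->|Zx] [->|Zy]; rewrite ?scaler0 ?add0r ?addr0; do ?by [left|right].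
    right; have -> : l *: x = (l - 1) *: x + x by rewrite scalerBl scale1r subrK.
    exact: linZ.
  by right; exact: linZ.
have capZ0 a : Z0 (c a) -> a = 0.
  by case=> [ca0|/capZ//]; apply: injc; rewrite ca0 linear0.
have oppZ0 z : Z0 z -> Z0 (- z).
  by move=> Zz; rewrite -[- z]addr0 -scaleN1r; apply: linZ0 => //; left.
(* Otherwise [Z0] together with the line through [x] would contradict maximality. *)
have full x : exists a, Z0 (x - c a).
  apply: contrapT => nex.
  pose Z' := [set y | exists (l : k) z, Z0 z /\ y = l *: x + z].
  have := maxZ Z'; apply; last split.
  - split=> [z Zz|ZZ']; first by exists 0, z; split; [right|rewrite scale0r add0r].
    have Zx : Z x by apply: ZZ'; exists 1, 0; split; [left|rewrite scale1r addr0].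
    by apply: nex; exists 0; rewrite linear0 subr0; right.
  - move=> l _ _ [l1 [z1 [Z1 ->]]] [l2 [z2 [Z2 ->]]].
    exists (l * l1 + l2), (l *: z1 + z2); split; first exact: linZ0.
    by rewrite scalerDr scalerA scalerDl !addrA; congr (_ + _); rewrite addrAC.
  - move=> a [l [z [Zz caE]]].
    have [l0|l0] := eqVneq l 0.
      by apply: capZ0; rewrite caE l0 scale0r add0r.
    case: nex; exists (l^-1 *: a); rewrite linearZ /= caE scalerDr scalerA mulVf //.
    rewrite scale1r opprD addrA subrr add0r; apply: oppZ0.
    by rewrite -[_ *: _]addr0; apply: linZ0 => //; left.
have [r rP] := choice full.
have uniq_r x a : Z0 (x - c a) -> r x = a.
  move=> Zxa; apply/eqP; rewrite -subr_eq0; apply/eqP/capZ0.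
  have -> : c (r x - a) = - 1 *: (x - c (r x)) + (x - c a).
    by rewrite linearB scaleN1r opprB addrA subrK.
  exact: linZ0.
have lin_r : linear r.
  move=> l x y; apply: uniq_r; rewrite linearP opprD addrACA -scalerBr.
  exact: linZ0.
have [g gr] := bundle_linear lin_r.
by exists g => a; rewrite gr; apply: uniq_r; rewrite subrr; left.
Qed.

Lemma exists_functional B (v : B) :
  v != 0 -> exists g : {linear B -> k^o}, g v = 1.
Proof.
move=> v0.
have lin_c : linear (fun x : k^o => (x : k) *: v : B).
  by move=> l x y; rewrite scalerDl scalerA.
have [c cE] := bundle_linear lin_c.
have [|r rc] := @linear_retraction k^o B c.
  move=> x y; rewrite !cE => /eqP; rewrite -subr_eq0 -scalerBl scaler_eq0.
  by rewrite (negPf v0) orbF subr_eq0 => /eqP.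
by exists r; rewrite -[RHS]rc cE scale1r.
Qed.

(** Gram-Schmidt with functionals in place of an inner product. The clause on [K] says that each
    [e i] lies in the span of [L]; it carries any linear property of the elements of [L] over to the
    [e i]. *)
Lemma exists_dual_basis A B (c : {linear A -> B}) (L : seq A) : injective c ->
  exists (n : nat) (e : 'I_n -> A) (f : 'I_n -> {linear B -> k^o}),
    [/\ forall i j, f i (c (e j)) = (i == j)%:R,
        forall x, x \in L -> x = \sum_i (f i (c x) : k) *: e i
      & forall K : set A, K 0 ->
          (forall (l : k) x y, K x -> K y -> K (l *: x + y)) ->
          (forall x, x \in L -> K x) -> forall i, K (e i)].
Proof.
move=> injc; elim: L => [|v L [n [e [f [fe eL eK]]]]].
  by exists 0, (fun i => 0), (fun i => \0); split=> [[]||? ? ? ? []].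
pose w := v - \sum_i (f i (c v) : k) *: e i.
have fw i : f i (c w) = 0.
  rewrite linearB linear_sum linearB linear_sum (bigD1 i) //= linearZ functionalZ.
  rewrite fe eqxx big1 ?addr0 /= ?mulr1 ?subrr// => j ji.
  by rewrite linearZ functionalZ fe eq_sym (negPf ji) mulr0.
have Kw (K : set A) : K 0 -> (forall (l : k) x y, K x -> K y -> K (l *: x + y)) ->
    (forall x, x \in v :: L -> K x) -> K w.
  move=> K0 Kl KL.
  have Ke : forall i, K (e i).
    by apply: eK => // x xL; apply: KL; rewrite inE xL orbT.
  suff KS (s : seq 'I_n) : K (\sum_(i <- s) (f i (c v) : k) *: e i).
    rewrite /w addrC -scaleN1r; apply: Kl; first exact: KS.
    by apply: KL; rewrite mem_head.
  by elim: s => [|i s IH]; rewrite ?big_nil// big_cons; exact: Kl.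
have [w0|w0] := eqVneq w 0.
  exists n, e, f; split=> //.
    move=> x; rewrite inE => /orP[/eqP ->|/eL//].
    by apply/eqP; rewrite -subr_eq0; apply/eqP.
  by move=> K K0 Kl KL; apply: eK => // x xL; apply: KL; rewrite inE xL orbT.
have cw0 : c w != 0 by apply: contra_neq w0 => cw; apply: injc; rewrite cw linear0.
have [g0 g0w] := exists_functional cw0.
(* [g0] is precomposed with the projection that kills the [c (e i)], which makes the new functional
   dual to the old vectors as well. *)
have lin_g : linear (fun x : B => g0 (x - \sum_i (f i x : k) *: c (e i))).
  move=> l x y; rewrite -linearP; congr (g0 _).
  rewrite scalerBr addrACA; congr (_ + _); rewrite -opprD scaler_sumr -big_split /=.
  congr (- _); apply: eq_bigr => i _.
  by rewrite linearP scalerDl scalerA.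
have [g gE] := bundle_linear lin_g.
have gw : g (c w) = 1.
  by rewrite gE big1 ?subr0// => i _; rewrite fw scale0r.
have ge i : g (c (e i)) = 0.
  rewrite gE (bigD1 i) //= fe eqxx scale1r big1 ?addr0 ?subrr ?linear0//.
  by move=> j ji; rewrite fe (negPf ji) scale0r.
exists n.+1, (fun i => if unlift ord0 i is Some j then e j else w).
exists (fun i => if unlift ord0 i is Some j then f j else g); split.
- move=> i j; case: (unliftP ord0 i) => [i'|] ->; case: (unliftP ord0 j) => [j'|] ->;
    rewrite ?unlift_none ?liftK ?fe ?fw ?ge ?gw ?eqxx//.
- move=> x; rewrite inE big_ord_recl unlift_none => xL.
  under eq_bigr do rewrite liftK.
  case/orP: xL => [/eqP ->|/eL xE].
    suff -> : g (c v) = 1 by rewrite scale1r subrK.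
    have -> : v = w + \sum_i (f i (c v) : k) *: e i by rewrite subrK.
    rewrite linearD linearD gw !linear_sum big1 ?addr0// => i _.
    by rewrite linearZ functionalZ ge mulr0.
  suff -> : g (c x) = 0 by rewrite scale0r add0r.
  by rewrite xE !linear_sum big1// => i _; rewrite linearZ functionalZ ge mulr0.
- move=> K K0 Kl KL i; case: (unliftP ord0 i) => [i' _|_]; last exact: Kw.
  by apply: eK => // x xL; apply: KL; rewrite inE xL orbT.
Qed.

End LinearAlgebra.

(** * Equality in tensor products *)

Section TensorEquality.
Variable k : fieldType.
Implicit Types A B W : lmodType k.

Lemma bilin_comp A B A' B' W (f : {linear A -> A'}) (g : {linear B -> B'})
    (phi : A' -> B' -> W) :
  bilin phi -> bilin (fun a b => phi (f a) (g b)).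
Proof. by case=> pl pr; split=> [a|b] c x y; rewrite linearP ?pl ?pr. Qed.

Lemma bilin_mul A B (C : algType k) (f : {linear A -> C}) (g : {linear B -> C}) :
  bilin (fun a b => f a * g b).
Proof.
split=> [a|b] c x y; first by rewrite linearP mulrDr -scalerAr.
by rewrite linearP mulrDl -scalerAl.
Qed.

Lemma bilin_comp_mull (A B : algType k) W (phi : A -> B -> W) a b :
  bilin phi -> bilin (fun x y => phi (a * x) (b * y)).
Proof.
by case=> pl pr; split=> [x|x] c y z; rewrite mulrDr -scalerAr ?pl ?pr.
Qed.

Lemma bilin_comp_mulr (A B : algType k) W (phi : A -> B -> W) a b :
  bilin phi -> bilin (fun x y => phi (x * a) (y * b)).
Proof.
by case=> pl pr; split=> [x|x] c y z; rewrite mulrDl -scalerAl ?pl ?pr.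
Qed.

Lemma bilin_scalel A B (f : {linear A -> k^o}) :
  @bilin k A B B (fun a b => (f a : k) *: b).
Proof.
split=> [a|b] c x y; first by rewrite scalerDr !scalerA mulrC.
by rewrite linearP scalerDl -scalerA.
Qed.

Lemma bilin_scaler A B (g : {linear B -> k^o}) :
  @bilin k A B A (fun a b => (g b : k) *: a).
Proof.
split=> [a|b] c x y; first by rewrite linearP scalerDl -scalerA.
by rewrite scalerDr !scalerA mulrC.
Qed.

Section Bilinear.
Variables (A B W : lmodType k) (phi : A -> B -> W) (bphi : bilin phi).

Lemma bilin0l b : phi 0 b = 0.
Proof.
have [_ /(_ b) pr] := bphi; have := pr (- 1) 0 0.
by rewrite scaler0 addr0 scaleN1r addNr.
Qed.

Lemma bilin0r a : phi a 0 = 0.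
Proof.
have [/(_ a) pl _] := bphi; have := pl (- 1) 0 0.
by rewrite scaler0 addr0 scaleN1r addNr.
Qed.

Lemma bilinDl a a' b : phi (a + a') b = phi a b + phi a' b.
Proof. by have [_ /(_ b) pr] := bphi; have := pr 1 a a'; rewrite !scale1r. Qed.

Lemma bilinDr a b b' : phi a (b + b') = phi a b + phi a b'.
Proof. by have [/(_ a) pl _] := bphi; have := pl 1 b b'; rewrite !scale1r. Qed.

Lemma bilinZl (c : k) a b : phi (c *: a) b = c *: phi a b.
Proof.
by have [_ /(_ b) pr] := bphi; have := pr c a 0; rewrite addr0 bilin0l addr0.
Qed.

Lemma bilinZr (c : k) a b : phi a (c *: b) = c *: phi a b.
Proof.
by have [/(_ a) pl _] := bphi; have := pl c b 0; rewrite addr0 bilin0r addr0.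
Qed.

Lemma bilin_suml I (r : seq I) (P : pred I) (F : I -> A) b :
  phi (\sum_(i <- r | P i) F i) b = \sum_(i <- r | P i) phi (F i) b.
Proof. by apply: (big_morph (phi^~ b) (fun a a' => bilinDl a a' b) (bilin0l b)). Qed.

Lemma bilin_sumr I (r : seq I) (P : pred I) (F : I -> B) a :
  phi a (\sum_(i <- r | P i) F i) = \sum_(i <- r | P i) phi a (F i).
Proof. by apply: (big_morph (phi a) (bilinDr a) (bilin0r a)). Qed.

End Bilinear.

Lemma tens_eq_trans A B (t s u : seq (A * B)) :
  tens_eq s t -> tens_eq t u -> tens_eq s u.
Proof. by move=> st tu W phi bphi; rewrite st// tu. Qed.

Lemma tens_eq_map A B A' B' (f : {linear A -> A'}) (g : {linear B -> B'})
    (s t : seq (A * B)) :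
  tens_eq s t -> tens_eq [seq (f p.1, g p.2) | p <- s] [seq (f p.1, g p.2) | p <- t].
Proof.
move=> st W phi bphi; rewrite !big_map.
exact: (st W _ (bilin_comp f g bphi)).
Qed.

(** A trilinear map on [A] becomes one on [B] by precomposition with a retraction of [c]. *)
Lemma tens_eq3_inj A B (c : {linear A -> B}) (s t : seq (A * A * A)) : injective c ->
  tens_eq3 [seq (c p.1.1, c p.1.2, c p.2) | p <- s]
           [seq (c p.1.1, c p.1.2, c p.2) | p <- t] ->
  tens_eq3 s t.
Proof.
move=> /linear_retraction[r rc] cst W phi [p1 p2 p3].
have tri : trilin (fun a b d => phi (r a) (r b) (r d)).
  by split=> x y l u v; rewrite linearP (p1, p2, p3).
have := cst W _ tri; rewrite !big_map /=.
by under eq_bigr do rewrite !rc; under [in RHS]eq_bigr do rewrite !rc.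
Qed.

(** With independent left legs, the right legs are determined by the tensor: they are its slices by
    the dual functionals [f i]. This is how information about single legs is read off an equality of
    tensors. *)
Lemma tens_eq_dual A B (s : seq (A * B)) :
  exists (n : nat) (e : 'I_n -> A) (f : 'I_n -> {linear A -> k^o}),
    (forall i j, f i (e j) = (i == j)%:R) /\
    tens_eq s [seq (e i, \sum_(p <- s) (f i p.1 : k) *: p.2) | i <- enum 'I_n].
Proof.
have [n [e [f [fe eL _]]]] := @exists_dual_basis k A A idfun (unzip1 s) (fun x y => id).
exists n, e, f; split=> [//|W phi bphi].
rewrite big_map big_enum /=.
transitivity (\sum_(p <- s) \sum_i (f i p.1 : k) *: phi (e i) p.2).
  rewrite big_seq [RHS]big_seq; apply: eq_bigr => p ps.
  rewrite {1}(eL p.1) ?map_f// (bilin_suml bphi); apply: eq_bigr => i _.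
  by rewrite (bilinZl bphi).
rewrite exchange_big; apply: eq_bigr => i _ /=.
by rewrite (bilin_sumr bphi); apply: eq_bigr => p _; rewrite (bilinZr bphi).
Qed.

End TensorEquality.

(** * Conilpotent Hopf algebras *)

Section Conilpotent.
Variable k : fieldType.
Implicit Types U V : affine_group k.

(* An increasing filtration by the order of nilpotency under the reduced
   coproduct [a |-> comul a - 1 (x) a]. *)
Fixpoint nilp U (n : nat) : set U :=
  if n is m.+1 then
    [set a | exists2 s, tens_eq (comul a) ((1, a) :: s)
                      & forall p, p \in s -> nilp m p.2]
  else [set 0].

Definition conilpotent U := forall a : U, exists n, nilp n a.

Lemma nilp0 U n : nilp n (0 : U).
Proof.
case: n => [//|n]; exists [::] => // W phi bphi.
rewrite big_seq1 /= (bilin0r bphi).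
have := comul_linear 1 (0 : U) 0 bphi; rewrite scaler0 addr0 big_cat big_map /=.
under [X in _ = X + _]eq_bigr do rewrite scale1r.
by move/eqP; rewrite -subr_eq0 opprD addrA subrr add0r oppr_eq0 => /eqP.
Qed.

Lemma nilp_linear U n (l : k) (a b : U) : nilp n a -> nilp n b -> nilp n (l *: a + b).
Proof.
elim: n l a b => [|n IH] l a b; first by move=> -> ->; rewrite scaler0 addr0.
move=> [s sa sn] [t tb tn].
exists ([seq (l *: p.1, p.2) | p <- s] ++ t) => [W phi bphi|p].
  rewrite (comul_linear l a b bphi) big_cons !big_cat !big_map /=.
  rewrite (tb _ _ bphi) big_cons (bilinDr bphi) (bilinZr bphi) addrACA.
  congr (_ + _); under eq_bigr do rewrite (bilinZl bphi).
  under [in RHS]eq_bigr do rewrite (bilinZl bphi).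
  by rewrite -!scaler_sumr (sa _ _ bphi) big_cons scalerDr.
rewrite mem_cat => /orP[/mapP[q qs ->]|pt]; [exact: (sn q qs)|exact: tn].
Qed.

Lemma nilpS U n (a : U) : nilp n a -> nilp n.+1 a.
Proof.
elim: n a => [|n IH] a; first by move=> ->; exact: nilp0.
by move=> [s sa sn]; exists s => // p /sn; exact: IH.
Qed.

Lemma nilp_leq U m n (a : U) : (m <= n)%N -> nilp m a -> nilp n a.
Proof.
move=> /subnK <-; elim: (n - m)%N => [//|d IH] /IH; rewrite addSn; exact: nilpS.
Qed.

Lemma nilp1 U : nilp 1 (1 : U).
Proof. by exists [::] => //; exact: comul1. Qed.

Lemma comul_mul U (a b : U) (s t : seq (U * U)) :
  tens_eq (comul a) s -> tens_eq (comul b) t ->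
  tens_eq (comul (a * b)) [seq (p.1 * q.1, p.2 * q.2) | p <- s, q <- t].
Proof.
move=> sa tb W phi bphi; rewrite (comulM a b bphi) !big_allpairs_dep /=.
transitivity (\sum_(p <- comul a) \sum_(q <- t) phi (p.1 * q.1) (p.2 * q.2)).
  apply: eq_bigr => p _.
  exact: (tb _ _ (bilin_comp_mull p.1 p.2 bphi)).
rewrite exchange_big [RHS]exchange_big; apply: eq_bigr => q _.
exact: (sa _ _ (bilin_comp_mulr q.1 q.2 bphi)).
Qed.

(** Expand (1 (x) a + s)(1 (x) b + t). The two cross terms lower only one of the two orders, hence
    the induction on [m + n]. *)
Lemma nilpM U m n (a b : U) : nilp m a -> nilp n b -> nilp (m + n) (a * b).
Proof.
have [N] := ubnP (m + n); elim: N m n a b => // N IH [|m] [|n] a b mnN.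
- by move=> -> _; rewrite mul0r; exact: nilp0.
- by move=> -> _; rewrite mul0r; exact: nilp0.
- by move=> _ ->; rewrite mulr0; exact: nilp0.
rewrite addSn ltnS in mnN.
move=> na nb; have [s sa sn] := na; have [t tb tn] := nb.
exists ([seq (q.1, a * q.2) | q <- t] ++
        ([seq (p.1, p.2 * b) | p <- s] ++
         [seq (p.1 * q.1, p.2 * q.2) | p <- s, q <- t])).
  apply: tens_eq_trans (comul_mul sa tb) _ => W phi bphi.
  rewrite big_allpairs_dep !big_cons !big_cat !big_map big_allpairs_dep /=.
  rewrite mulr1 -addrA; congr (_ + (_ + _)).
    by apply: eq_bigr => q _; rewrite mul1r.
  rewrite -big_split; apply: eq_bigr => p _ /=.
  by rewrite big_cons /= mulr1.
move=> p; rewrite !mem_cat => 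
  /or3P[/mapP[q qt ->]|/mapP[q qs ->]|/allpairsPdep[q [r [qs rt ->]]]] /=.
- by rewrite addnS -addSn; apply: IH => //; [rewrite addSn -addnS|apply: tn].
- by apply: IH => //; exact: sn.
- apply: (@nilp_leq _ (m + n)); first by rewrite leq_add2l.
  apply: IH; [|exact: sn|exact: tn].
  by apply: leq_ltn_trans mnN; rewrite leq_add2l.
Qed.

Lemma nilp_comorph U V (f : ghom U V) n (b : V) : nilp n b -> nilp n (comorph f b).
Proof.
elim: n b => [|n IH] b; first by move=> ->; rewrite /= linear0.
move=> [s sb sn]; exists [seq (comorph f p.1, comorph f p.2) | p <- s].
  apply: tens_eq_trans (comorph_comul f b) _.
  by have := tens_eq_map (comorph f) (comorph f) sb; rewrite /= rmorph1.
by move=> p /mapP[q /sn/IH + ->].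
Qed.

(** The list [s] witnessing the order in [U] need not come from [V]. So the reduced coproduct of [b]
    is rewritten with independent left legs; its right legs are slices, and their images in [U] are
    combinations of the right legs of [s]. *)
Lemma nilp_injective U V (f : ghom U V) n (b : V) :
  injective (comorph f) -> nilp n (comorph f b) -> nilp n b.
Proof.
move=> injf; elim: n b => [|n IH] b /=.
  by move=> fb; apply: injf; rewrite fb linear0.
move=> [s sb sn].
have [r rf] := linear_retraction injf.
have [m [e [g [ge bE]]]] := tens_eq_dual ((- 1, b) :: comul b).
exists [seq (e i, \sum_(p <- (- 1, b) :: comul b) (g i p.1 : k) *: p.2) | i <- enum 'I_m].
  move=> W phi bphi; rewrite big_cons -(bE _ _ bphi) big_cons /=.
  by rewrite -scaleN1r (bilinZl bphi) scaleN1r addrA subrr add0r.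
move=> _ /mapP[i _ ->] /=; apply: IH.
have -> : comorph f (\sum_(p <- (- 1, b) :: comul b) (g i p.1 : k) *: p.2) =
          \sum_(p <- s) (g i (r p.1) : k) *: p.2.
  rewrite big_cons linearD linearZ linear_sum /=.
  transitivity ((g i (- 1) : k) *: comorph f b +
      \sum_(p <- comul (comorph f b)) (g i (r p.1) : k) *: p.2).
    congr (_ + _); rewrite (comorph_comul f b (bilin_scalel _ (g i \o r))) big_map.
    by apply: eq_bigr => p _; rewrite linearZ /= rf.
  rewrite (sb _ _ (bilin_scalel _ (g i \o r))) big_cons addrA -scalerDl /=.
  by rewrite -(rmorph1 (comorph f)) rf linearN addNr scale0r add0r.
elim: s sn {sb} => [|p s IHs] sn; first by rewrite big_nil; exact: nilp0.
rewrite big_cons; apply: nilp_linear; first by apply: sn; rewrite mem_head.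
by apply: IHs => q qs; apply: sn; rewrite inE qs orbT.
Qed.

Lemma conilpotent_subalgebra U : is_subalgebra [set a : U | exists n, nilp n a].
Proof.
split=> [|l a b [m ma] [n nb]|a b [m ma] [n nb]].
- by exists 1; exact: nilp1.
- by exists (maxn m n); apply: nilp_linear; [apply: nilp_leq ma|apply: nilp_leq nb];
    rewrite (leq_maxl, leq_maxr).
- by exists (m + n); exact: nilpM.
Qed.

Lemma generates_algebra_ind (A : comAlgType k) (S B : set A) :
  generates_algebra S -> is_subalgebra B -> S `<=` B -> forall a, B a.
Proof.
move=> genS subB SB a; apply: (smallest_sub subB SB).
by rewrite [smallest _ _]genS.
Qed.

(** The order of [a i j] is governed by its distance from the diagonal: in the coproduct the terms
    with l < i vanish, l = i gives 1 (x) [a i j], and l > i gives a right leg closer to the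
    diagonal. *)
Lemma unitriangular_conilpotent U m (a : 'M[U]_m) :
  unitriangular_embedding a -> conilpotent U.
Proof.
move=> [triu comula _ gena].
have nilpa d (i j : 'I_m) : (j < i + d)%N -> nilp d (a i j).
  elim: d i j => [|d IH] i j; rewrite ?addn0 ?addnS ?ltnS => ji.
    rewrite triu ?(ltnW ji)// (_ : i == j = false)//.
    by rewrite -val_eqE; exact: gtn_eqF.
  have [ji'|ij] := ltnP j i; first by apply: nilpS; apply: IH; rewrite ltn_addr.
  exists [seq (a i l, a l j) | l : 'I_m <- enum 'I_m & (i < l)%N].
    apply: tens_eq_trans (comula i j) _ => W phi bphi.
    rewrite big_map big_enum big_cons big_map /= big_filter big_enum_cond /=.
    rewrite (bigD1 i)//= triu// eqxx; congr (_ + _).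
    rewrite (bigID (fun l : 'I_m => (i < l)%N)) /= [X in _ + X]big1 ?addr0; last first.
      move=> l /andP[li il]; rewrite triu; last by rewrite leqNgt.
      by rewrite eq_sym (negPf li) (bilin0l bphi).
    apply: eq_bigl => l; rewrite andb_idl// => il.
    by rewrite -val_eqE /= gtn_eqF.
  move=> p /mapP[l]; rewrite mem_filter => /andP[il _] -> /=; apply: IH.
  by rewrite (leq_ltn_trans ji)// ltn_add2r.
apply: (generates_algebra_ind gena (conilpotent_subalgebra U)).
by move=> _ [i [j ->]]; exists j.+1; apply: nilpa; rewrite addnS ltnS leq_addl.
Qed.

End Conilpotent.

Section ComulSums.
Variables (k : fieldType) (U : affine_group k) (A W : lmodType k).

Lemma comul_sum_linear (phi : U -> U -> W) : bilin phi ->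
  linear (fun a => \sum_(p <- comul a) phi p.1 p.2).
Proof.
move=> bphi c a b; rewrite (comul_linear c a b bphi) big_cat big_map /=.
congr (_ + _); rewrite scaler_sumr; apply: eq_bigr => p _.
by rewrite (bilinZl bphi).
Qed.

Lemma trilin_comull (psi : U -> U -> A -> W) : trilin psi ->
  bilin (fun x z => \sum_(q <- comul x) psi q.1 q.2 z).
Proof.
move=> [p1 p2 p3]; split=> [x|z] l y y'.
  by rewrite scaler_sumr -big_split; apply: eq_bigr => q _; exact: p1.
exact: (comul_sum_linear (phi := fun x y => psi x y z)).
Qed.

Lemma trilin_comulr (psi : A -> U -> U -> W) : trilin psi ->
  bilin (fun x z => \sum_(q <- comul z) psi x q.1 q.2).
Proof.
move=> [p1 p2 p3]; split=> [x|z] l y y'; first exact: (comul_sum_linear (phi := psi x)).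
by rewrite scaler_sumr -big_split; apply: eq_bigr => q _; exact: p3.
Qed.

End ComulSums.

(** * Matrix coefficients of finite-dimensional comodules *)

Section Comodules.
Variables (k : fieldType) (U : affine_group k).

(** The matrix of a finite-dimensional representation of [U], as a matrix of functions on [U]. *)
Definition comatrix n (m : 'M[U]_n) : Prop :=
  (forall i j, tens_eq (comul (m i j)) [seq (m i l, m l j) | l <- enum 'I_n]) /\
  (forall i j, counit U (m i j) = (i == j)%:R).

(** Apply [f j] to the last leg of the coassociativity identity for [v i]: by independence of the
    [v j], this isolates the coproduct of [m i j]. The counit on the right leg recovers [v i] from
    the entries. *)
Lemma comodule_comatrix n (v : 'I_n -> U) (f : 'I_n -> {linear U -> k^o})
    (m : 'M[U]_n) :
  (forall i j, f i (v j) = (i == j)%:R) ->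
  (forall i, tens_eq (comul (v i)) [seq (m i j, v j) | j <- enum 'I_n]) ->
  comatrix m /\ forall i, v i = \sum_j (counit U (v j) : k) *: m i j.
Proof.
move=> fv vm; split; last first.
  move=> i; rewrite -[LHS](counitr (v i)) (vm i _ _ (bilin_scaler _ (counit U))).
  by rewrite big_map big_enum.
split=> i j; last first.
  have := counitl (v i); rewrite (vm i _ _ (bilin_scalel _ (counit U))).
  rewrite big_map big_enum /= => /(congr1 (f j)).
  rewrite linear_sum (bigD1 j) //= functionalZ !fv eqxx mulr1 big1 ?addr0.
    by rewrite eq_sym.
  by move=> l lj; rewrite functionalZ fv eq_sym (negPf lj) mulr0.
move=> W phi bphi; rewrite big_map big_enum /=.
pose psi (x y z : U) := (f j z : k) *: phi x y.
have tpsi : trilin psi.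
  split=> [a b|a c|b c] l x y; rewrite /psi.
  - by rewrite linearP scalerDl scalerA.
  - by rewrite (bilinDr bphi) (bilinZr bphi) scalerDr !scalerA mulrC.
  - by rewrite (bilinDl bphi) (bilinZl bphi) scalerDr !scalerA mulrC.
have := comulA (v i) tpsi; rewrite !big_allpairs_dep /=.
rewrite (vm i _ _ (trilin_comull tpsi)) big_map big_enum.
rewrite (vm i _ _ (trilin_comulr tpsi)) big_map big_enum /=.
have fvE (F : 'I_n -> W) : \sum_l (f j (v l) : k) *: F l = F j.
  rewrite (bigD1 j) //= fv eqxx scale1r big1 ?addr0// => l lj.
  by rewrite fv eq_sym (negPf lj) scale0r.
under eq_bigr do rewrite -scaler_sumr.
rewrite fvE => ->; apply: eq_bigr => l _.
have bphi' : bilin (psi (m i l)) by have [p1 p2 _] := tpsi.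
by rewrite (vm l _ _ bphi') big_map big_enum /= fvE.
Qed.

End Comodules.

(** * Invariant flags, and the embedding into U_m *)

Section TriangularComodules.
Variables (k : fieldType) (U : affine_group k).

Definition triangular_comodule n (v : 'I_n -> U) (f : 'I_n -> {linear U -> k^o})
    (m : 'M[U]_n) : Prop :=
  [/\ forall i j, f i (v j) = (i == j)%:R,
      forall i j : 'I_n, (j <= i)%N -> m i j = (i == j)%:R
    & forall i, tens_eq (comul (v i)) [seq (m i j, v j) | j <- enum 'I_n]].

Definition in_span n (v : 'I_n -> U) : set U :=
  [set x | exists c : 'I_n -> k, x = \sum_i c i *: v i].

(** Modulo the span of [v] the coaction on [x] is trivial. Putting the part [w] of [x] independent
    of [v] in front of the family adds a first row (1, b) above [m], so the matrix stays
    unitriangular. *)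
Lemma triangular_comodule_extend n (v : 'I_n -> U) f m (x : U) (s : seq (U * U)) :
  triangular_comodule v f m -> tens_eq (comul x) ((1, x) :: s) ->
  (forall p, p \in s -> in_span v p.2) ->
  exists n' (v' : 'I_n' -> U) f' m', triangular_comodule v' f' m' /\
    in_span v `<=` in_span v' /\ in_span v' x.
Proof.
move=> [fv um vm] xs sv.
have spanE y : in_span v y -> y = \sum_i (f i y : k) *: v i.
  move=> [c ->]; apply: eq_bigr => i _; rewrite linear_sum (bigD1 i) //=.
  rewrite functionalZ fv eqxx mulr1 big1 ?addr0// => j ji.
  by rewrite functionalZ fv eq_sym (negPf ji) mulr0.
pose w := x - \sum_i (f i x : k) *: v i.
have fw i : f i w = 0.
  rewrite linearB linear_sum (bigD1 i) //= functionalZ.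
  rewrite fv eqxx big1 ?addr0 /= ?mulr1 ?subrr// => j ji.
  by rewrite functionalZ fv eq_sym (negPf ji) mulr0.
have [w0|w0] := eqVneq w 0.
  exists n, v, f, m; split=> //; split=> //.
  by exists (f^~ x); apply/eqP; rewrite -subr_eq0; apply/eqP.
have [g0 g0w] := exists_functional w0.
have lin_g : linear (fun y : U => g0 (y - \sum_i (f i y : k) *: v i)).
  move=> l y z; rewrite -linearP; congr (g0 _).
  rewrite scalerBr addrACA; congr (_ + _); rewrite -opprD scaler_sumr -big_split /=.
  congr (- _); apply: eq_bigr => i _.
  by rewrite linearP scalerDl scalerA.
have [g gE] := bundle_linear lin_g.
have gw : g w = 1.
  by rewrite gE big1 ?subr0// => i _; rewrite fw scale0r.
have gv i : g (v i) = 0.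
  rewrite gE (bigD1 i) //= fv eqxx scale1r big1 ?addr0 ?subrr ?linear0//.
  by move=> j ji; rewrite fv (negPf ji) scale0r.
(* The coefficient of [v j] in the coproduct of [w] minus 1 (x) [w]: the contribution of [s], that
   of 1 (x) (x - w), and the coaction on the subtracted combination of the [v i]. *)
pose b j := \sum_(p <- s) (f j p.2 : k) *: p.1 + (f j x : k) *: 1 -
            \sum_i (f i x : k) *: m i j.
have wb : tens_eq (comul w) ((1, w) :: [seq (b j, v j) | j <- enum 'I_n]).
  move=> W phi bphi; have lin_cm := comul_sum_linear bphi.
  have [cm cmE] := bundle_linear lin_cm.
  rewrite -cmE linearB linear_sum cmE (xs _ _ bphi) !big_cons big_map big_enum /=.
  rewrite {1}(_ : x = w + \sum_i (f i x : k) *: v i); last by rewrite subrK.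
  rewrite (bilinDr bphi) -!addrA; congr (_ + _).
  rewrite /b; under [RHS]eq_bigr do
    rewrite -scaleN1r (bilinDl bphi) (bilinDl bphi) (bilinZl bphi) (bilin_suml bphi).
  rewrite !big_split /= addrA; congr (_ + _); last first.
    under [RHS]eq_bigr do rewrite (bilinZl bphi) (bilin_suml bphi).
    rewrite -scaler_sumr scaleN1r; congr (- _).
    rewrite exchange_big; apply: eq_bigr => i _ /=.
    rewrite linearZ /= cmE (vm i _ _ bphi) big_map big_enum /= scaler_sumr.
    by apply: eq_bigr => j _; rewrite (bilinZl bphi).
  rewrite addrC; congr (_ + _); last first.
    by rewrite (bilin_sumr bphi); apply: eq_bigr => i _; rewrite (bilinZr bphi).
  rewrite exchange_big big_seq [RHS]big_seq; apply: eq_bigr => p ps /=.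
  rewrite {1}(spanE _ (sv p ps)) (bilin_sumr bphi); apply: eq_bigr => i _.
  by rewrite (bilinZr bphi) (bilinZl bphi).
pose v' (i : 'I_n.+1) := if unlift ord0 i is Some i' then v i' else w.
pose f' (i : 'I_n.+1) := if unlift ord0 i is Some i' then f i' else g.
pose m' := \matrix_(i < n.+1, j < n.+1)
  match unlift ord0 i, unlift ord0 j with
  | Some i', Some j' => m i' j'
  | Some i', None => 0
  | None, Some j' => b j'
  | None, None => 1
  end.
have sumE (W : lmodType k) (phi : U -> U -> W) i :
    \sum_(p <- [seq (m' i j, v' j) | j <- enum 'I_n.+1]) phi p.1 p.2 =
    phi (m' i ord0) w + \sum_j phi (m' i (lift ord0 j)) (v j).
  rewrite big_map big_enum /= big_ord_recl /v' unlift_none; congr (_ + _).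
  by apply: eq_bigr => j _; rewrite liftK.
exists n.+1, v', f', m'; split; last first.
  split.
    move=> _ [c ->].
    exists (fun i => if unlift ord0 i is Some j then c j else 0).
    rewrite big_ord_recl unlift_none scale0r add0r; apply: eq_bigr => i _.
    by rewrite /v' liftK.
  exists (fun i => if unlift ord0 i is Some j then f j x else 1).
  rewrite big_ord_recl /v' unlift_none scale1r.
  under eq_bigr do rewrite liftK.
  by rewrite subrK.
split.
- move=> i j; rewrite /f' /v'; case: (unliftP ord0 i) => [i'|] ->;
    case: (unliftP ord0 j) => [j'|] ->; by rewrite ?fv ?fw ?gv ?gw.
- move=> i j; rewrite mxE; case: (unliftP ord0 i) => [i'|] ->;
    case: (unliftP ord0 j) => [j'|] -> //.
  by move=> /um; rewrite (inj_eq lift_inj).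
- move=> i W phi bphi; rewrite sumE.
  case: (unliftP ord0 i) => [i'|] -> {i}.
    rewrite /v' liftK mxE liftK unlift_none (bilin0l bphi) add0r (vm i' _ _ bphi).
    rewrite big_map big_enum; apply: eq_bigr => j _ /=.
    by rewrite mxE !liftK.
  rewrite /v' unlift_none mxE unlift_none (wb _ _ bphi) big_cons big_map big_enum /=.
  by congr (_ + _); apply: eq_bigr => j _; rewrite mxE unlift_none liftK.
Qed.

Lemma triangular_comodule_extends n (v : 'I_n -> U) f m (L : seq U) :
  triangular_comodule v f m ->
  (forall x, x \in L -> exists2 s, tens_eq (comul x) ((1, x) :: s)
     & forall p, p \in s -> in_span v p.2) ->
  exists n' (v' : 'I_n' -> U) f' m', triangular_comodule v' f' m' /\
    in_span v `<=` in_span v' /\ forall x, x \in L -> in_span v' x.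
Proof.
elim: L n v f m => [|x L IH] n v f m tv xL.
  by exists n, v, f, m; split=> [//|]; split=> x.
have [s xs sv] := xL x (mem_head _ _).
have [n1 [v1 [f1 [m1 [tv1 [vv1 xv1]]]]]] := triangular_comodule_extend tv xs sv.
have [|n2 [v2 [f2 [m2 [tv2 [vv2 Lv2]]]]]] := IH _ _ _ _ tv1.
  move=> y yL; have [|s' ys' s'v] := xL y; first by rewrite inE yL orbT.
  by exists s' => // p /s'v; exact: vv1.
exists n2, v2, f2, m2; split=> //; split; first exact: subset_trans vv2.
by move=> y; rewrite inE => /orP[/eqP ->|/Lv2//]; exact: vv2.
Qed.

(** The right legs of the reduced coproducts of [L] form a finite list of order one less; a flag for
    them exists by induction, and the elements of [L] are then added one at a time. *)
Lemma nilp_triangular_comodule d (L : seq U) : (forall x, x \in L -> nilp d x) ->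
  exists n (v : 'I_n -> U) f m, triangular_comodule v f m /\
    forall x, x \in L -> in_span v x.
Proof.
elim: d L => [|d IH] L nL.
  exists 0, (fun=> 0), (fun=> \0), 0; split.
    by split=> [[]|[]|[]].
  by move=> x /nL ->; exists (fun=> 0); rewrite big_ord0.
have /choice[S SP] : forall x, exists s, x \in L ->
    tens_eq (comul x) ((1, x) :: s) /\ forall p, p \in s -> nilp d p.2.
  move=> x.
  have [/nL[s xs sn]|xL] := boolP (x \in L); first by exists s.
  by exists [::].
have [|n [v [f [m [tv Lv]]]]] := IH (flatten [seq unzip2 (S x) | x <- L]).
  by move=> _ /flatten_mapP[x xL /mapP[p pS ->]]; have [_] := SP x xL; apply.
have [|n' [v' [f' [m' [tv' [_ Lv']]]]]] := triangular_comodule_extends (L := L) tv.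
  move=> x xL; have [xS _] := SP x xL; exists (S x) => // p pS.
  by apply: Lv; apply/flatten_mapP; exists x => //; exact: map_f.
by exists n', v', f', m'.
Qed.

(** The generators lie in the span of a triangular comodule, hence in the span of its matrix
    entries, so the entries generate. *)
Lemma conilpotent_unipotent : algebraic U -> conilpotent U -> unipotent U.
Proof.
move=> [s gens] cU; split; first by exists s.
have [N nN] : exists N, forall x, x \in s -> nilp N x.
  elim: s {gens} => [|x s [N nN]]; first by exists 0.
  have [M nM] := cU x; exists (maxn M N) => y; rewrite inE => /orP[/eqP ->|/nN].
    by apply: nilp_leq nM; exact: leq_maxl.
  by apply: nilp_leq; exact: leq_maxr.
have [n [v [f [m [[fv um vm] sv]]]]] := nilp_triangular_comodule nN.
have [[mc me] vE] := comodule_comatrix fv vm.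
exists n, m; split=> //.
apply/seteqP; split=> // a _ B [[B1 Bl BM] mB] /=.
have B0 : B 0 by rewrite -(addNr 1) -scaleN1r; apply: Bl.
have Bsum I (r : seq I) (F : I -> k) (G : I -> U) : (forall i, B (G i)) ->
    B (\sum_(i <- r) F i *: G i).
  by move=> BG; elim: r => [|i r IH]; rewrite ?big_nil// big_cons; exact: Bl.
apply: (generates_algebra_ind gens) => // x /sv[c ->].
apply: (Bsum) => i; rewrite vE; apply: Bsum => j.
by apply: mB; exists i, j.
Qed.

End TriangularComodules.

Section Bundling.
Variables (k : fieldType) (A B : comAlgType k).

Lemma bundle_lrmorphism (f : A -> B) :
  linear f -> monoid_morphism f -> exists g : {lrmorphism A -> B}, g =1 f.
Proof.
move=> lf mf; pose m1 := GRing.isLinear.Build k A B _ f lf.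
pose m2 := GRing.isMonoidMorphism.Build A B f mf.
by exists (HB.pack_for {lrmorphism A -> B} f m1 m2).
Qed.

End Bundling.

(** * Hopf subalgebras and the quotient groups they define *)

Section Subalgebra.
Variables (k : fieldType) (A : comAlgType k) (B : set A) (subB : is_subalgebra B).

(** The proof is an argument so that the closure instance can be recovered from the predicate
    itself. *)
Definition subalg_pred of is_subalgebra B : pred A := fun a => `[< B a >].

Fact subalg_pred_closed : GRing.subsemialg_closed (subalg_pred subB).
Proof.
have [B1 Bl BM] := subB.
have B0 : B 0 by rewrite -(addNr 1) -scaleN1r; apply: Bl.
apply: GRing.subalg_closed_semi; split; rewrite ?unfold_in; first exact/asboolP.
- by move=> c a b /asboolP Ba /asboolP Bb; apply/asboolP; exact: Bl.
- by move=> a b /asboolP Ba /asboolP Bb; apply/asboolP; exact: BM.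
Qed.
HB.instance Definition _ :=
  GRing.isSubalgClosed.Build k A (subalg_pred subB) subalg_pred_closed.

Record subalg := Subalg { subalg_val : A; _ : subalg_val \in subalg_pred subB }.
HB.instance Definition _ := [isSub for subalg_val].
HB.instance Definition _ := [Choice of subalg by <:].
HB.instance Definition _ := [SubChoice_isSubComNzRing of subalg by <:].
HB.instance Definition _ := [SubZmodule_isSubLmodule of subalg by <:].
HB.instance Definition _ := [SubNzRing_SubLmodule_isSubLalgebra of subalg by <:].
HB.instance Definition _ := [SubLalgebra_isSubAlgebra of subalg by <:].
Definition subalg_incl (x : subalg) : A := subalg_val x.
Fact subalg_incl_linear : linear subalg_incl.
Proof. exact: (linearP (val : subalg -> A)). Qed.
Fact subalg_incl_monoid : monoid_morphism subalg_incl.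
Proof. by split; [exact: (rmorph1 (val : subalg -> A))|exact: (rmorphM (val : subalg -> A))]. Qed.
HB.instance Definition _ := GRing.isLinear.Build k subalg A _ subalg_incl subalg_incl_linear.
HB.instance Definition _ := GRing.isMonoidMorphism.Build subalg A subalg_incl subalg_incl_monoid.
Lemma subalg_incl_inj : injective subalg_incl.
Proof. exact: val_inj. Qed.
Lemma subalg_inclP x : B (subalg_incl x).
Proof. by case: x => a Ba; exact/asboolP. Qed.
Lemma exists_subalg_incl a : B a -> exists x, subalg_incl x = a.
Proof. by move=> /asboolP Ba; exists (Subalg Ba). Qed.

End Subalgebra.


Section HopfSubalgebra.
Variables (k : fieldType) (U : affine_group k) (B : set U).
Hypothesis subB : is_subalgebra B.
Hypothesis comulB : forall a, B a ->
  exists2 s, tens_eq (comul a) s & forall p, p \in s -> B p.1 /\ B p.2.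
Hypothesis antipodeB : forall a, B a -> B (antipode U a).

Local Notation P := (subalg subB).
Local Notation incl := (@subalg_incl k U B subB).

(** The coproduct is chosen by lifting the lists given by [comulB]. Each axiom, tested on forms on
    the subalgebra, is moved to [U] by the retraction [r] or by the injectivity of the inclusion. *)
Lemma hopf_subalgebra :
  exists (Q : affine_group k) (f : ghom U Q),
    injective (comorph f) /\ range (comorph f) = B.
Proof.
have [r rK] := linear_retraction (@subalg_incl_inj _ _ _ subB).
have /choice[cm cmP] : forall x : P, exists s : seq (P * P),
    tens_eq (comul (incl x)) [seq (incl p.1, incl p.2) | p <- s].
  move=> x; have [s xs sB] := comulB (subalg_inclP x).
  suff [t tE] : exists t : seq (P * P), s = [seq (incl p.1, incl p.2) | p <- t].
    by exists t; rewrite -tE.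
  elim: s sB {xs} => [|[p1 p2] s IH] sB; first by exists [::].
  have [|t ->] := IH; first by move=> q qs; apply: sB; rewrite inE qs orbT.
  have [/= /exists_subalg_incl-/(_ subB)[y1 <-] /exists_subalg_incl-/(_ subB)[y2 <-]] :=
    sB _ (mem_head _ _).
  by exists ((y1, y2) :: t).
have cmE (W : lmodType k) (phi : U -> U -> W) x : bilin phi ->
    \sum_(p <- cm x) phi (incl p.1) (incl p.2) = \sum_(p <- comul (incl x)) phi p.1 p.2.
  by move=> bphi; rewrite (cmP x _ _ bphi) big_map.
have cmrE (W : lmodType k) (phi : P -> P -> W) x : bilin phi ->
    \sum_(p <- cm x) phi p.1 p.2 = \sum_(p <- comul (incl x)) phi (r p.1) (r p.2).
  move=> bphi; rewrite -(cmE _ _ _ (bilin_comp r r bphi)).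
  by apply: eq_bigr => p _; rewrite !rK.
have /choice[S SE] : forall x : P, exists y : P, incl y = antipode U (incl x).
  by move=> x; apply: exists_subalg_incl; apply: antipodeB; exact: subalg_inclP.
have lS : linear S.
  by move=> c x y; apply: subalg_incl_inj; rewrite SE !linearP /= !SE.
have [S' S'E] := bundle_linear lS.
have Qlin (c : k) (a b : P) :
    tens_eq (cm (c *: a + b)) ([seq (c *: p.1, p.2) | p <- cm a] ++ cm b).
  move=> W phi bphi; rewrite big_cat big_map cmrE// linearP.
  rewrite (comul_sum_linear (bilin_comp r r bphi)) -!cmrE//; congr (_ + _).
  by rewrite scaler_sumr; apply: eq_bigr => p _; rewrite (bilinZl bphi).
have Q1 : tens_eq (cm 1) [:: (1, 1)].
  move=> W phi bphi; rewrite cmrE// rmorph1 (comul1 (bilin_comp r r bphi)) !big_seq1 /=.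
  by rewrite -(rmorph1 incl) rK.
have QM (a b : P) :
    tens_eq (cm (a * b)) [seq (p.1 * q.1, p.2 * q.2) | p <- cm a, q <- cm b].
  move=> W phi bphi; rewrite cmrE// rmorphM (comulM _ _ (bilin_comp r r bphi)).
  rewrite !big_allpairs_dep /=.
  transitivity (\sum_(p <- comul (incl a)) \sum_(q <- cm b)
      phi (r (p.1 * incl q.1)) (r (p.2 * incl q.2))).
    apply: eq_bigr => p _.
    by rewrite (cmE _ _ _ (bilin_comp_mull p.1 p.2 (bilin_comp r r bphi))).
  rewrite exchange_big [RHS]exchange_big; apply: eq_bigr => q _ /=.
  rewrite -(cmE _ _ _ (bilin_comp_mulr (incl q.1) (incl q.2) (bilin_comp r r bphi))).
  by apply: eq_bigr => p _; rewrite -!rmorphM !rK.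
have QA (a : P) : tens_eq3 [seq (q.1, q.2, p.2) | p <- cm a, q <- cm p.1]
                           [seq (p.1, q.1, q.2) | p <- cm a, q <- cm p.2].
  apply: (tens_eq3_inj (@subalg_incl_inj _ _ _ subB)) => W phi tphi.
  rewrite !big_map !big_allpairs_dep /=; have [phi1 phi2 phi3] := tphi.
  transitivity (\sum_(p <- comul (incl a)) \sum_(q <- comul p.1) phi q.1 q.2 p.2).
    rewrite -(cmE _ _ _ (trilin_comull tphi)); apply: eq_bigr => p _.
    exact: (cmE _ (fun x y => phi x y (incl p.2))).
  transitivity (\sum_(p <- comul (incl a)) \sum_(q <- comul p.2) phi p.1 q.1 q.2).
    by have := comulA (incl a) tphi; rewrite !big_allpairs_dep.
  rewrite -(cmE _ _ _ (trilin_comulr tphi)); apply: eq_bigr => p _.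
  by rewrite (cmE _ (phi (incl p.1))).
have Ql (a : P) : \sum_(p <- cm a) (counit U (incl p.1) : k) *: p.2 = a.
  apply: subalg_incl_inj; rewrite linear_sum.
  under eq_bigr do rewrite linearZ /=.
  by rewrite (cmE _ _ _ (bilin_scalel _ (counit U))) counitl.
have Qr (a : P) : \sum_(p <- cm a) (counit U (incl p.2) : k) *: p.1 = a.
  apply: subalg_incl_inj; rewrite linear_sum.
  under eq_bigr do rewrite linearZ /=.
  by rewrite (cmE _ _ _ (bilin_scaler _ (counit U))) counitr.
have QSl (a : P) : \sum_(p <- cm a) S' p.1 * p.2 = (counit U (incl a) : k) *: 1.
  apply: subalg_incl_inj; rewrite linear_sum linearZ rmorph1 [RHS]/= -antipodel.
  under eq_bigr do rewrite rmorphM S'E /= SE.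
  exact: (cmE _ _ _ (bilin_mul (antipode U) idfun)).
have QSr (a : P) : \sum_(p <- cm a) p.1 * S' p.2 = (counit U (incl a) : k) *: 1.
  apply: subalg_incl_inj; rewrite linear_sum linearZ rmorph1 [RHS]/= -antipoder.
  under eq_bigr do rewrite rmorphM S'E /= SE.
  exact: (cmE _ _ _ (bilin_mul idfun (antipode U))).
pose Q := @AffineGroup k P cm (counit U \o incl) S' Qlin Q1 QM QA Ql Qr QSl QSr.
have fcm (b : Q) : tens_eq (comul (incl b)) [seq (incl p.1, incl p.2) | p <- comul b].
  exact: cmP.
exists Q, (@GHom k U Q incl fcm (fun=> erefl)); split; first exact: subalg_incl_inj.
apply/seteqP; split=> [_ [x _ <-]|a Ba]; first exact: subalg_inclP.
by have [x <-] := exists_subalg_incl subB Ba; exists x.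
Qed.

End HopfSubalgebra.


(** * Quotients by Hopf ideals, that is, closed subgroups *)

Section QuotientAlgebra.
Variables (k : fieldType) (A : comAlgType k) (I : set A).
Definition proper_alg_ideal : Prop :=
  [/\ I 0, forall a b, I a -> I b -> I (a + b), forall a b, I b -> I (a * b) & ~ I 1].
Hypothesis idI : proper_alg_ideal.
Definition alg_ideal_pred of proper_alg_ideal : pred A := fun a => `[< I a >].

Fact alg_ideal_closed : idealr_closed (alg_ideal_pred idI).
Proof.
have [I0 ID IM I1] := idI.
split; rewrite ?unfold_in; [exact/asboolP|exact/asboolP|].
by move=> a x y /asboolP Ix /asboolP Iy; apply/asboolP/ID => //; exact: IM.
Qed.
HB.instance Definition _ := isIdealr.Build A (alg_ideal_pred idI) alg_ideal_closed.

Definition quot_alg : Type := {ideal_quot [the idealr A of alg_ideal_pred idI]}.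
HB.instance Definition _ := GRing.ComNzRing.on quot_alg.
Definition quot_pi : A -> quot_alg := (\pi_({ideal_quot [the idealr A of alg_ideal_pred idI]}))%qT.
Fact quot_pi_zmod : zmod_morphism quot_pi.
Proof. exact: rmorphB. Qed.
Fact quot_pi_monoid : monoid_morphism quot_pi.
Proof. split; [exact: rmorph1|exact: rmorphM]. Qed.
HB.instance Definition _ := GRing.isZmodMorphism.Build A quot_alg quot_pi quot_pi_zmod.
HB.instance Definition _ := GRing.isMonoidMorphism.Build A quot_alg quot_pi quot_pi_monoid.

(** Scalars act through their image in the quotient ring, so the algebra axioms become ring
    identities. *)
Definition quot_scale (c : k) (x : quot_alg) : quot_alg := quot_pi c%:A * x.
Fact quot_scaleA c d x : quot_scale c (quot_scale d x) = quot_scale (c * d) x.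
Proof. by rewrite /quot_scale mulrA -rmorphM -scalerAl mul1r scalerA. Qed.
Fact quot_scale1 : left_id 1 quot_scale.
Proof. by move=> x; rewrite /quot_scale scale1r rmorph1 mul1r. Qed.
Fact quot_scaleDr : right_distributive quot_scale +%R.
Proof. by move=> c x y; rewrite /quot_scale mulrDr. Qed.
Fact quot_scaleDl x : {morph quot_scale^~ x : c d / c + d}.
Proof. by move=> c d; rewrite /quot_scale scalerDl rmorphD mulrDl. Qed.
HB.instance Definition _ := GRing.Zmodule_isLmodule.Build k quot_alg
  quot_scaleA quot_scale1 quot_scaleDr quot_scaleDl.
Fact quot_scalerAl (c : k) (x y : quot_alg) : c *: (x * y) = c *: x * y.
Proof. exact: mulrA. Qed.
HB.instance Definition _ := GRing.Lmodule_isLalgebra.Build k quot_alg quot_scalerAl.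
Fact quot_scalerAr (c : k) (x y : quot_alg) : c *: (x * y) = x * (c *: y).
Proof. exact: mulrCA. Qed.
HB.instance Definition _ := GRing.Lalgebra_isAlgebra.Build k quot_alg quot_scalerAr.
Fact quot_pi_scalable : scalable quot_pi.
Proof. by move=> c x; rewrite -[RHS]rmorphM /= -scalerAl mul1r. Qed.
HB.instance Definition _ := GRing.isScalable.Build k A quot_alg _ quot_pi quot_pi_scalable.

Lemma quot_pi_eq0 a : quot_pi a = 0 <-> I a.
Proof.
have piE : (quot_pi a == quot_pi 0) = (a \in alg_ideal_pred idI).
  by rewrite -[in RHS](subr0 a) Quotient.idealrBE.
rewrite rmorph0 in piE; split=> [/eqP|Ia]; first by rewrite piE => /asboolP.
by apply/eqP; rewrite piE; apply/asboolP.
Qed.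
Lemma quot_pi_surj x : exists a, quot_pi a = x.
Proof.
exists (repr (x : {ideal_quot [the idealr A of alg_ideal_pred idI]})).
by rewrite /quot_pi reprK.
Qed.
End QuotientAlgebra.

Section HopfQuotient.
Variables (k : fieldType) (U : affine_group k) (I : set U).
Hypothesis hopfI : hopf_ideal I.

Lemma hopf_ideal_proper : proper_alg_ideal I.
Proof.
have [[I0 ID IM] _ Ie _] := hopfI; split=> // /Ie.
by rewrite rmorph1 => /eqP; rewrite oner_eq0.
Qed.

Local Notation H := (quot_alg hopf_ideal_proper).
Local Notation pi := (@quot_pi k U I hopf_ideal_proper).

Lemma hopf_quotient :
  exists (Q : affine_group k) (f : ghom Q U),
    (forall b, exists a, comorph f a = b) /\ (forall a, comorph f a = 0 <-> I a).
Proof.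
have [[I0 ID IM] Icm Ie IS] := hopfI.
have pi0 a : pi a = 0 <-> I a by exact: quot_pi_eq0.
have piP x : exists a, pi a = x by exact: quot_pi_surj.
have /choice[rep repK] := piP.
have repI a : I (rep (pi a) - a) by apply/pi0; rewrite rmorphB /= repK subrr.
pose cm x := [seq (pi p.1, pi p.2) | p <- comul (rep x)].
(* Independence of the representative: two of them differ by an element of [I], and each term of its
   coproduct has a leg killed by [pi]. *)
have cmE (W : lmodType k) (phi : H -> H -> W) a : bilin phi ->
    \sum_(p <- cm (pi a)) phi p.1 p.2 = \sum_(p <- comul a) phi (pi p.1) (pi p.2).
  move=> bphi; have bphi' := bilin_comp pi pi bphi.
  have [c cE] := bundle_linear (comul_sum_linear bphi').
  rewrite big_map -!cE; apply/eqP; rewrite -subr_eq0 -linearB cE.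
  have [s sE sI] := Icm _ (repI a); rewrite (sE _ _ bphi'); apply/eqP.
  rewrite big_seq big1// => p /sI[] /pi0 /= ->; first exact: (bilin0l bphi).
  exact: (bilin0r bphi).
have epi x y : pi x = pi y -> counit U x = counit U y.
  move=> xy; apply/eqP; rewrite -subr_eq0 -linearB; apply/eqP/Ie/pi0.
  by rewrite rmorphB /= xy subrr.
pose e0 (x : H) : k^o := counit U (rep x).
have e0E a : e0 (pi a) = counit U a by apply: epi; rewrite repK.
have le0 : linear e0.
  move=> c x y; have [a <-] := piP x; have [b <-] := piP y.
  by rewrite -linearP !e0E linearP.
have me0 : monoid_morphism e0.
  split; first by rewrite -(rmorph1 pi) e0E rmorph1.
  move=> x y; have [a <-] := piP x; have [b <-] := piP y.
  by rewrite -rmorphM !e0E rmorphM.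
have [e e0e] := @bundle_lrmorphism k H k^o e0 le0 me0.
have eE a : e (pi a) = counit U a by rewrite e0e.
pose S0 (x : H) : H := pi (antipode U (rep x)).
have S0E a : S0 (pi a) = pi (antipode U a).
  apply/eqP; rewrite -subr_eq0 -rmorphB -linearB; apply/eqP/pi0; exact: IS.
have lS0 : linear S0.
  move=> c x y; have [a <-] := piP x; have [b <-] := piP y.
  by rewrite -linearP !S0E !linearP.
have [S SS0] := bundle_linear lS0.
have SE a : S (pi a) = pi (antipode U a) by rewrite SS0.
have Qlin (c : k) (x y : H) :
    tens_eq (cm (c *: x + y)) ([seq (c *: p.1, p.2) | p <- cm x] ++ cm y).
  have [a <-] := piP x; have [b <-] := piP y.
  move=> W phi bphi; rewrite -linearP cmE// big_cat big_map.
  rewrite (comul_sum_linear (bilin_comp pi pi bphi)) -!cmE//; congr (_ + _).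
  by rewrite scaler_sumr; apply: eq_bigr => p _; rewrite (bilinZl bphi).
have Q1 : tens_eq (cm 1) [:: (1, 1)].
  move=> W phi bphi; rewrite -(rmorph1 pi) cmE//.
  by rewrite (comul1 (bilin_comp pi pi bphi)) !big_seq1.
have QM (x y : H) :
    tens_eq (cm (x * y)) [seq (p.1 * q.1, p.2 * q.2) | p <- cm x, q <- cm y].
  have [a <-] := piP x; have [b <-] := piP y.
  move=> W phi bphi; rewrite -rmorphM cmE// (comulM _ _ (bilin_comp pi pi bphi)).
  rewrite !big_allpairs_dep /=.
  transitivity (\sum_(p <- comul a) \sum_(q <- cm (pi b))
      phi (pi p.1 * q.1) (pi p.2 * q.2)).
    apply: eq_bigr => p _.
    rewrite (cmE _ _ _ (bilin_comp_mull (pi p.1) (pi p.2) bphi)).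
    by apply: eq_bigr => q _; rewrite !rmorphM.
  rewrite exchange_big [RHS]exchange_big; apply: eq_bigr => q _ /=.
  by rewrite (cmE _ _ _ (bilin_comp_mulr q.1 q.2 bphi)).
have QA (x : H) : tens_eq3 [seq (q.1, q.2, p.2) | p <- cm x, q <- cm p.1]
                           [seq (p.1, q.1, q.2) | p <- cm x, q <- cm p.2].
  move=> W phi [phi1 phi2 phi3].
  have tphi : trilin (fun x y z => phi (pi x) (pi y) (pi z)).
    by split=> u v c w w'; rewrite linearP (phi1, phi2, phi3).
  have := comulA (rep x) tphi; rewrite !big_allpairs_dep !big_map /= => compA.
  transitivity (\sum_(p <- comul (rep x)) \sum_(q <- comul p.1)
      phi (pi q.1) (pi q.2) (pi p.2)).
    by apply: eq_bigr => p _; rewrite (cmE _ (fun x y => phi x y (pi p.2))).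
  by rewrite compA; apply: eq_bigr => p _; rewrite (cmE _ (phi (pi p.1))).
have Ql (x : H) : \sum_(p <- cm x) (e p.1 : k) *: p.2 = x.
  have [a <-] := piP x; rewrite (cmE _ _ _ (bilin_scalel _ e)) -[RHS](congr1 pi (counitl a)).
  by rewrite linear_sum; apply: eq_bigr => p _; rewrite linearZ /= eE.
have Qr (x : H) : \sum_(p <- cm x) (e p.2 : k) *: p.1 = x.
  have [a <-] := piP x; rewrite (cmE _ _ _ (bilin_scaler _ e)) -[RHS](congr1 pi (counitr a)).
  by rewrite linear_sum; apply: eq_bigr => p _; rewrite linearZ /= eE.
have QSl (x : H) : \sum_(p <- cm x) S p.1 * p.2 = (e x : k) *: 1.
  have [a <-] := piP x; rewrite (cmE _ _ _ (bilin_mul S idfun)) eE /=.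
  rewrite -(rmorph1 pi) -linearZ -antipodel linear_sum.
  by apply: eq_bigr => p _; rewrite rmorphM SE.
have QSr (x : H) : \sum_(p <- cm x) p.1 * S p.2 = (e x : k) *: 1.
  have [a <-] := piP x; rewrite (cmE _ _ _ (bilin_mul idfun S)) eE /=.
  rewrite -(rmorph1 pi) -linearZ -antipoder linear_sum.
  by apply: eq_bigr => p _; rewrite rmorphM SE.
pose Q := @AffineGroup k H cm e S Qlin Q1 QM QA Ql Qr QSl QSr.
have fcm (a : U) : tens_eq (@comul k Q (pi a)) [seq (pi p.1 : Q, pi p.2 : Q) | p <- comul a].
  by move=> W phi bphi; rewrite [RHS]big_map; exact: (cmE W phi a bphi).
by exists Q, (@GHom k Q U pi fcm eE).
Qed.

End HopfQuotient.

(** * Local finiteness of the coordinate ring *)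

Section LocalFiniteness.
Variables (k : fieldType) (U : affine_group k).

(** Write the coproduct of [a] as a sum of [e i] (x) [c i] with the [e i] independent. The [c i]
    span a finite-dimensional subcomodule, which contains [a] by the counit axiom; [a] is then a
    combination of its matrix coefficients. *)
Lemma exists_comatrix (a : U) : exists n (m : 'M[U]_n),
  comatrix m /\ exists c : 'M[k]_n, a = \sum_i \sum_j c i j *: m i j.
Proof.
have [n [e [f [fe aE]]]] := tens_eq_dual (comul a).
set c := fun i => \sum_(p <- comul a) (f i p.1 : k) *: p.2 in aE.
(* Apply [f i] to the first leg of coassociativity for [a]. *)
have cE i : tens_eq (comul (c i))
    [seq (\sum_(q <- comul (e l)) (f i q.1 : k) *: q.2, c l) | l <- enum 'I_n].
  move=> W phi bphi; rewrite big_map big_enum /=.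
  pose psi (x y z : U) := (f i x : k) *: phi y z.
  have tpsi : trilin psi.
    split=> [x y|x z|y z] l u v; rewrite /psi.
    - by rewrite (bilinDr bphi) (bilinZr bphi) scalerDr !scalerA mulrC.
    - by rewrite (bilinDl bphi) (bilinZl bphi) scalerDr !scalerA mulrC.
    - by rewrite linearP scalerDl scalerA.
  have := comulA a tpsi; rewrite !big_allpairs_dep /=.
  rewrite (aE _ _ (trilin_comull tpsi)) big_map big_enum.
  rewrite (aE _ _ (trilin_comulr tpsi)) big_map big_enum /= => psiE.
  transitivity (\sum_l \sum_(q <- comul (c l)) psi (e l) q.1 q.2).
    rewrite [RHS](bigD1 i) //= [X in _ + X]big1 ?addr0 /psi => [|l li].
      by rewrite fe eqxx; apply: eq_bigr => q _; rewrite scale1r.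
    by rewrite fe eq_sym (negPf li) big1// => q _; rewrite scale0r.
  rewrite -psiE; apply: eq_bigr => l _.
  by rewrite (bilin_suml bphi); apply: eq_bigr => q _; rewrite (bilinZl bphi).
have [r [v [g [gv cv Kv]]]] := @exists_dual_basis k U U idfun (map c (enum 'I_n)) (fun x y => id).
(* Having a coproduct with right legs among the [c l] is a linear condition, so it passes from the
   [c i] to the basis [v] of their span. *)
have vc i : exists w : 'I_n -> U, tens_eq (comul (v i)) [seq (w l, c l) | l <- enum 'I_n].
  move: i; apply: (Kv [set x | exists w : 'I_n -> U,
      tens_eq (comul x) [seq (w l, c l) | l <- enum 'I_n]]).
  - exists (fun=> 0) => W phi bphi; have [h hE] := bundle_linear (comul_sum_linear bphi).
    by rewrite -hE linear0 big_map big1// => l _; rewrite (bilin0l bphi).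
  - move=> l x y [w xw] [w' yw']; exists (fun j => l *: w j + w' j) => W phi bphi.
    rewrite (comul_sum_linear bphi) (xw _ _ bphi) (yw' _ _ bphi) !big_map.
    rewrite scaler_sumr -big_split; apply: eq_bigr => j _ /=.
    by rewrite (bilinDl bphi) (bilinZl bphi).
  - by move=> _ /mapP[i _ ->]; exists (fun l => \sum_(q <- comul (e l)) (f i q.1 : k) *: q.2).
have /choice[w wE] := vc.
pose m := \matrix_(i, j) \sum_l (g j (c l) : k) *: w i l.
have vm i : tens_eq (comul (v i)) [seq (m i j, v j) | j <- enum 'I_r].
  apply: tens_eq_trans (wE i) _ => W phi bphi.
  rewrite big_map big_enum [RHS]big_map big_enum /=.
  transitivity (\sum_l \sum_j (g j (c l) : k) *: phi (w i l) (v j)).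
    apply: eq_bigr => l _; rewrite {1}(cv (c l)) ?map_f ?mem_enum// (bilin_sumr bphi).
    by apply: eq_bigr => j _; rewrite (bilinZr bphi).
  rewrite exchange_big; apply: eq_bigr => j _ /=.
  by rewrite mxE (bilin_suml bphi); apply: eq_bigr => l _; rewrite (bilinZl bphi).
have [cm_m vE'] := comodule_comatrix gv vm.
have vE i : v i = \sum_j (counit U (v j) : k) *: m i j := vE' i.
exists r, m; split=> //.
exists (\matrix_(i, j) ((\sum_l (counit U (e l) : k) * (g i (c l) : k)) * (counit U (v j) : k))).
have -> : a = \sum_l (counit U (e l) : k) *: c l.
  by rewrite -{1}(counitl a) (aE _ _ (bilin_scalel _ (counit U))) big_map big_enum.
transitivity (\sum_l \sum_i ((counit U (e l) : k) * (g i (c l) : k)) *: v i).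
  apply: eq_bigr => l _; rewrite {1}(cv (c l)) ?map_f ?mem_enum// scaler_sumr.
  by apply: eq_bigr => i _; rewrite scalerA.
rewrite exchange_big; apply: eq_bigr => i _ /=; rewrite -scaler_suml vE scaler_sumr.
by apply: eq_bigr => j _; rewrite mxE scalerA.
Qed.

End LocalFiniteness.

(** * Properties of the antipode, and algebraic quotients *)

Section Antipode.
Variables (k : fieldType) (U : affine_group k).
Local Notation S := (antipode U).

Lemma antipode_comatrix n (m : 'M[U]_n) : comatrix m ->
  map_mx S m *m m = 1%:M /\ m *m map_mx S m = 1%:M.
Proof.
move=> [mc me]; split; apply/matrixP=> i j; rewrite !mxE.
  transitivity ((counit U (m i j) : k) *: (1 : U)).
    rewrite -antipodel (mc i j _ _ (bilin_mul S idfun)) big_map big_enum /=.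
    by apply: eq_bigr => l _; rewrite mxE.
  by rewrite me scaler_nat.
transitivity ((counit U (m i j) : k) *: (1 : U)).
  rewrite -antipoder (mc i j _ _ (bilin_mul idfun S)) big_map big_enum /=.
  by apply: eq_bigr => l _; rewrite mxE.
by rewrite me scaler_nat.
Qed.

Lemma antipode1 : S 1 = 1.
Proof.
have := antipodel (1 : U); rewrite (comul1 (bilin_mul S idfun)) big_seq1 /= mulr1.
by rewrite rmorph1 scale1r.
Qed.

(* On entries of comatrices [m] and [m'], both sides are inverse to the
   Kronecker product of [m] and [m']. *)
Lemma antipodeM a b : S (a * b) = S a * S b.
Proof.
have [n [m [cm_m [c ->]]]] := exists_comatrix a.
have [n' [m' [cm_m' [c' ->]]]] := exists_comatrix b.
suff SM i j i' j' : S (m i j * m' i' j') = S (m i j) * S (m' i' j').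
  pose phi1 (x y : U) := S (x * y); pose phi2 (x y : U) := S x * S y.
  have b1 : bilin phi1.
    split=> [x|x] l y z; first by rewrite /phi1 mulrDr -scalerAr linearP.
    by rewrite /phi1 mulrDl -scalerAl linearP.
  have b2 : bilin phi2 by exact: bilin_mul.
  rewrite -[LHS]/(phi1 _ _) -[RHS]/(phi2 _ _).
  rewrite (bilin_suml b1) (bilin_suml b2); apply: eq_bigr => i _.
  rewrite (bilin_suml b1) (bilin_suml b2); apply: eq_bigr => j _.
  rewrite (bilin_sumr b1) (bilin_sumr b2); apply: eq_bigr => i' _.
  rewrite (bilin_sumr b1) (bilin_sumr b2); apply: eq_bigr => j' _.
  by rewrite (bilinZl b1) (bilinZr b1) (bilinZl b2) (bilinZr b2) /phi1 SM.
have [/matrixP _ /matrixP mS] := antipode_comatrix cm_m.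
have [/matrixP _ /matrixP mS'] := antipode_comatrix cm_m'.
have Sm l l' h h' : \sum_i0 \sum_i0' S (m l i0 * m' l' i0') * (m i0 h * m' i0' h') =
    (l == h)%:R * (l' == h')%:R.
  have bS := bilin_mul S idfun.
  have [mc me] := cm_m; have [mc' me'] := cm_m'.
  transitivity ((counit U (m l h * m' l' h') : k) *: (1 : U)).
    rewrite -antipodel (comul_mul (mc l h) (mc' l' h') bS).
    rewrite big_allpairs_dep big_map big_enum; apply: eq_bigr => x _ /=.
    by rewrite big_map big_enum.
  by rewrite rmorphM /= me me' -natrM scaler_nat natrM.
pose F h h' := S (m h j) * S (m' h' j').
(* This sum collapses in two ways: over h, h' by [mS] and [mS'] to the left side, over l, l' by [Sm]
   to [F i i']. *)
transitivity (\sum_l \sum_l' \sum_h \sum_h'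
    S (m i l * m' i' l') * (m l h * m' l' h') * F h h').
  transitivity (\sum_l \sum_l' S (m i l * m' i' l') * ((l == j)%:R * (l' == j')%:R)).
    rewrite (bigD1 j) //= [X in _ + X]big1 ?addr0 => [|l /negPf lj]; last first.
      by rewrite big1// => l' _; rewrite lj mul0r mulr0.
    rewrite (bigD1 j') //= !eqxx !mulr1 big1 ?addr0// => l' /negPf ->.
    by rewrite !mulr0.
  apply: eq_bigr => l _; apply: eq_bigr => l' _.
  have := mS l j; have := mS' l' j'; rewrite !mxE => <- <-.
  rewrite big_distrlr mulr_sumr; apply: eq_bigr => h _ /=.
  rewrite mulr_sumr; apply: eq_bigr => h' _.
  by rewrite !mxE /F -[RHS]mulrA; congr (_ * _); rewrite mulrACA.
under eq_bigr => l _ do rewrite exchange_big.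
rewrite exchange_big /=.
under eq_bigr => h _ do under eq_bigr => l _ do rewrite exchange_big.
under eq_bigr => h _ do rewrite exchange_big.
transitivity (\sum_h \sum_h' ((i == h)%:R * (i' == h')%:R) * F h h').
  apply: eq_bigr => h _; apply: eq_bigr => h' _ /=; rewrite -Sm mulr_suml.
  by apply: eq_bigr => l _; rewrite mulr_suml.
rewrite (bigD1 i) //= [X in _ + X]big1 ?addr0 => [|h]; last first.
  by rewrite eq_sym => /negPf ih; rewrite big1// => h' _; rewrite ih !mul0r.
rewrite (bigD1 i') //= !eqxx !mul1r big1 ?addr0// => h'.
by rewrite eq_sym => /negPf ->; rewrite mulr0 mul0r.
Qed.

(* Over the algebra U (x) U, both sides are entries of the inverse of the
   matrix [comul m]. *)
Lemma comul_antipode n (m : 'M[U]_n) i j : comatrix m ->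
  tens_eq (comul (S (m i j))) [seq (S (m l j), S (m i l)) | l <- enum 'I_n].
Proof.
move=> cm_m W phi bphi; rewrite big_map big_enum /=.
have [mc me] := cm_m.
have [/matrixP Sm /matrixP mS] := antipode_comatrix cm_m.
(* Over U (x) U let X be the coproduct of S(m), Y that of m, and Z the claimed value of X. This is Y
   Z = 1 and [left_inv] is X Y = 1; the free form [psi] absorbs the third factor in X = X (Y Z) = (X
   Y) Z. *)
have right_inv (psi : U -> U -> W) x y : bilin psi ->
    \sum_l \sum_h \sum_h' psi (m x h * S (m h' y)) (m h l * S (m l h')) =
    (x == y)%:R *: psi 1 1.
  move=> bpsi; rewrite exchange_big /=.
  under eq_bigr => h _ do rewrite exchange_big.
  transitivity (\sum_h \sum_h' (h == h')%:R *: psi (m x h * S (m h' y)) 1).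
    apply: eq_bigr => h _; apply: eq_bigr => h' _ /=.
    rewrite -(bilin_sumr bpsi) -(bilinZr bpsi) scaler_nat; congr psi.
    by have := mS h h'; rewrite !mxE => <-; apply: eq_bigr => l _; rewrite mxE.
  transitivity (\sum_h psi (m x h * S (m h y)) 1).
    apply: eq_bigr => h _; rewrite (bigD1 h) //= eqxx scale1r big1 ?addr0// => h'.
    by rewrite eq_sym => /negPf ->; rewrite scale0r.
  rewrite -(bilin_suml bpsi) -(bilinZl bpsi) scaler_nat; congr psi.
  by have := mS x y; rewrite !mxE => <-; apply: eq_bigr => l _; rewrite mxE.
have left_inv (psi : U -> U -> W) x y : bilin psi ->
    \sum_l \sum_(p <- comul (S (m x l))) \sum_h psi (p.1 * m l h) (p.2 * m h y) =
    (x == y)%:R *: psi 1 1.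
  move=> bpsi; have [c cE] := bundle_linear (comul_sum_linear bpsi).
  transitivity (c (\sum_l S (m x l) * m l y)).
    rewrite linear_sum; apply: eq_bigr => l _.
    rewrite cE (comul_mul (fun _ _ _ => erefl) (mc l y) bpsi) big_allpairs_dep.
    by apply: eq_bigr => p _; rewrite big_map big_enum.
  have -> : \sum_l S (m x l) * m l y = (x == y)%:R *: (1 : U).
    by have := Sm x y; rewrite !mxE scaler_nat => <-; apply: eq_bigr => l _; rewrite mxE.
  by rewrite linearZ cE (comul1 bpsi) big_seq1.
transitivity (\sum_x \sum_(p <- comul (S (m i x))) (x == j)%:R *: phi p.1 p.2).
  rewrite (bigD1 j) //= eqxx [X in _ + X]big1 ?addr0 => [|l /negPf ->].
    by apply: eq_bigr => p _; rewrite scale1r.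
  by rewrite big1// => p _; rewrite scale0r.
transitivity (\sum_x \sum_(p <- comul (S (m i x))) \sum_l \sum_h \sum_h'
    phi (p.1 * m x h * S (m h' j)) (p.2 * m h l * S (m l h'))).
  apply: eq_bigr => x _; apply: eq_bigr => p _.
  have := right_inv _ x j (bilin_comp_mull p.1 p.2 bphi); rewrite !mulr1 => <-.
  by apply: eq_bigr => l _; apply: eq_bigr => h _; apply: eq_bigr => h' _; rewrite !mulrA.
transitivity (\sum_l \sum_h' \sum_x \sum_(p <- comul (S (m i x))) \sum_h
    phi (p.1 * m x h * S (m h' j)) (p.2 * m h l * S (m l h'))).
  under eq_bigr => x _ do rewrite exchange_big.
  rewrite exchange_big /=; apply: eq_bigr => l _.
  under eq_bigr => x _ do under eq_bigr => p _ do rewrite exchange_big.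
  under eq_bigr => x _ do rewrite exchange_big.
  by rewrite exchange_big.
transitivity (\sum_l \sum_h' (i == l)%:R *: phi (S (m h' j)) (S (m l h'))).
  apply: eq_bigr => l _; apply: eq_bigr => h' _.
  have := left_inv _ i l (bilin_comp_mulr (S (m h' j)) (S (m l h')) bphi).
  by rewrite !mul1r.
rewrite (bigD1 i) //= eqxx [X in _ + X]big1 ?addr0 => [|l].
  by apply: eq_bigr => h _; rewrite scale1r.
by rewrite eq_sym => /negPf il; rewrite big1// => h _; rewrite il scale0r.
Qed.

Lemma counit_antipode_comatrix n (m : 'M[U]_n) i j : comatrix m ->
  counit U (S (m i j)) = (i == j)%:R.
Proof.
move=> cm_m; have [/matrixP Sm _] := antipode_comatrix cm_m.
have := congr1 (counit U) (Sm i j); rewrite !mxE rmorph_nat => <-.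
rewrite rmorph_sum (bigD1 j) //= big1 ?addr0 => [|l lj].
  by rewrite rmorphM mxE /= (proj2 cm_m) eqxx mulr1.
by rewrite rmorphM /= (proj2 cm_m) (negPf lj) mulr0.
Qed.

(** Since S reverses the coproduct, the transpose of S(m) is again a comatrix. Its image under S and
    the transpose of m are both inverse to it. *)
Lemma antipodeK_comatrix n (m : 'M[U]_n) i j : comatrix m -> S (S (m i j)) = m i j.
Proof.
move=> cm_m; have [Sm mS] := antipode_comatrix cm_m.
have cm_S : comatrix (map_mx S m)^T.
  split=> x y; rewrite !mxE; last by rewrite counit_antipode_comatrix// eq_sym.
  apply: tens_eq_trans (comul_antipode _ _ cm_m) _ => W phi bphi.
  by rewrite !big_map; apply: eq_bigr => l _; rewrite !mxE.
have [SSm _] := antipode_comatrix cm_S.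
have mSt : (map_mx S m)^T *m m^T = 1%:M by rewrite -trmx_mul mS trmx1.
have E : map_mx S (map_mx S m)^T = m^T.
  by rewrite -[LHS]mulmx1 -mSt mulmxA SSm mul1mx.
by have /matrixP/(_ j i) := E; rewrite !mxE.
Qed.

(** Take the subalgebra generated by the entries of a comatrix for [a] and their antipodes: S
    exchanges the two families of generators, and the coproduct preserves each. *)
Lemma exists_algebraic_quotient (a : U) :
  exists (Q : affine_group k) (f : ghom U Q),
    [/\ quotient_map f, algebraic Q & exists b, comorph f b = a].
Proof.
have [n [m [cm_m [c aE]]]] := exists_comatrix a.
pose gen := [seq m i j | i <- enum 'I_n, j <- enum 'I_n] ++
            [seq S (m i j) | i <- enum 'I_n, j <- enum 'I_n].
pose B := smallest (@is_subalgebra k U) [set` gen].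
have subB : is_subalgebra B.
  split=> [C [[C1 _ _] _]//|l x y Bx By C CP|x y Bx By C CP]; have [[_ Cl CM] _] := CP.
    by apply: Cl; [exact: Bx|exact: By].
  by apply: CM; [exact: Bx|exact: By].
have genm i j : m i j \in gen.
  by rewrite mem_cat allpairs_f ?mem_enum.
have genS i j : S (m i j) \in gen.
  by rewrite mem_cat (allpairs_f (fun i j => S (m i j))) ?mem_enum ?orbT.
have Bgen x : x \in gen -> B x by move=> xg C [_]; apply.
have B_ind (C : set U) : is_subalgebra C -> (forall i j, C (m i j)) ->
    (forall i j, C (S (m i j))) -> B `<=` C.
  move=> subC Cm CS; apply: smallest_sub => // x /=.
  by rewrite mem_cat => /orP[|] /allpairsP[[i j] [_ _ ->]].
have [B1 Bl BM] := subB.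
have comulB : forall x, B x ->
    exists2 s, tens_eq (comul x) s & forall p, p \in s -> B p.1 /\ B p.2.
  apply: B_ind.
  - split=> [|l x y [s xs sB] [t yt tB]|x y [s xs sB] [t yt tB]].
    + exists [:: (1, 1)]; first exact: comul1.
      by move=> p; rewrite inE => /eqP ->.
    + exists ([seq (l *: p.1, p.2) | p <- s] ++ t) => [W phi bphi|p].
        rewrite (comul_sum_linear bphi) (xs _ _ bphi) (yt _ _ bphi) big_cat big_map.
        by rewrite scaler_sumr; congr (_ + _); apply: eq_bigr => p _; rewrite (bilinZl bphi).
      rewrite mem_cat => /orP[/mapP[q /sB[q1 q2] ->]|/tB//]; split=> //=.
      by rewrite -[_ *: _]addr0 -(addNr 1) -scaleN1r; apply: (Bl) => //; exact: Bl.
    + exists [seq (p.1 * q.1, p.2 * q.2) | p <- s, q <- t]; first exact: comul_mul.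
      move=> _ /allpairsPdep[p [q [/sB[p1 p2] /tB[q1 q2] ->]]].
      by split; exact: BM.
  - move=> i j; exists [seq (m i l, m l j) | l <- enum 'I_n]; first exact: (proj1 cm_m).
    by move=> _ /mapP[l _ ->]; split; apply: Bgen; exact: genm.
  - move=> i j; exists [seq (S (m l j), S (m i l)) | l <- enum 'I_n].
      exact: comul_antipode.
    by move=> _ /mapP[l _ ->]; split; apply: Bgen; exact: genS.
have antipodeB : forall x, B x -> B (S x).
  apply: B_ind => [|i j|i j]; last 2 first.
  - by apply: Bgen; exact: genS.
  - by rewrite /= antipodeK_comatrix//; apply: Bgen; exact: genm.
  split=> [|l x y Sx Sy|x y Sx Sy] /=; first by rewrite antipode1.
    by rewrite linearP; exact: Bl.
  by rewrite antipodeM; exact: BM.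
have [Q [f [injf fB]]] := hopf_subalgebra subB comulB antipodeB.
have Bf x : B x -> exists b, comorph f b = x by rewrite -fB => -[b _ <-]; exists b.
exists Q, f; split=> //; last first.
  apply: Bf; rewrite aE; have B0 : B 0 by rewrite -(addNr 1) -scaleN1r; apply: Bl.
  have Bsum I (r : seq I) (F : I -> U) : (forall i, B (F i)) -> B (\sum_(i <- r) F i).
    move=> BF; elim: r => [|i r IH]; rewrite ?big_nil// big_cons -[F i]scale1r.
    exact: Bl.
  apply: (Bsum) => i; apply: Bsum => j; rewrite -[_ *: _]addr0; apply: Bl => //.
  by apply: Bgen; exact: genm.
have lift (s : seq U) : (forall x, x \in s -> B x) ->
    exists t : seq Q, s = [seq comorph f b | b <- t].
  elim: s => [|x s IH] sB; first by exists [::].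
  have [b fb] := Bf x (sB x (mem_head _ _)).
  have [|t tE] := IH; first by move=> y ys; apply: sB; rewrite inE ys orbT.
  by exists (b :: t); rewrite /= fb -tE.
have [t tE] := lift gen Bgen; exists t.
apply/seteqP; split=> // b _ C [[C1 Cl CM] tC].
(* The image of [C] is a subalgebra of [U] containing [gen], hence contains [B]; injectivity pulls
   this back to [Q]. *)
suff [b' Cb' /injf <-] : exists2 b', C b' & comorph f b' = comorph f b by [].
suff : B `<=` [set x | exists2 b', C b' & comorph f b' = x].
  by apply; rewrite -fB; exists b.
apply: smallest_sub.
  split=> [|l x y [x' Cx <-] [y' Cy <-]|x y [x' Cx <-] [y' Cy <-]].
  - by exists 1 => //; rewrite rmorph1.
  - by exists (l *: x' + y'); [exact: Cl|rewrite linearP].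
  - by exists (x' * y'); [exact: CM|rewrite rmorphM].
by move=> x /=; rewrite tE => /mapP[y yt ->]; exists y => //; exact: tC.
Qed.

End Antipode.

(** * The convolution algebra of linear forms *)

Section ConvolutionAlgebra.
Variables (k : fieldType) (U : affine_group k).
Implicit Types (f g h : U -> k) (x y : points U).

Definition functional f : Prop :=
  forall (c : k) (a b : U), f (c *: a + b) = c * f a + f b.

Lemma functional0 f : functional f -> f 0 = 0.
Proof. by move=> lf; have := lf (- 1) 0 0; rewrite scaler0 addr0 mulN1r addNr. Qed.

Lemma functional_point x : functional x.
Proof. by move=> c a b; rewrite linearP. Qed.

Lemma functional_counit : functional (counit U).
Proof. exact: (functional_point (counit U : points U)). Qed.

Lemma bilin_functionals f g : functional f -> functional g ->
  @bilin k U U k^o (fun a b => f a * g b).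
Proof.
move=> lf lg; split=> [a|b] c u v.
  by rewrite lg mulrDr mulrCA.
by rewrite lf mulrDl -mulrA.
Qed.

Lemma conv_functional f g : functional f -> functional g -> functional (conv f g).
Proof. by move=> lf lg c a b; exact: (comul_sum_linear (bilin_functionals lf lg)). Qed.

Lemma convA f g h : functional f -> functional g -> functional h ->
  conv f (conv g h) =1 conv (conv f g) h.
Proof.
move=> lf lg lh a; rewrite /conv.
have tfgh : @trilin k U U U k^o (fun a b c => f a * g b * h c).
  split=> [u v|u v|u v] c w w'.
  - by rewrite lh mulrDr mulrCA.
  - by rewrite lg mulrDr mulrDl; congr (_ + _); rewrite mulrCA -!mulrA.
  - by rewrite lf !mulrDl -!mulrA.
have := comulA a tfgh; rewrite !big_allpairs_dep /= => E.
under eq_bigr do rewrite mulr_sumr; under [RHS]eq_bigr do rewrite mulr_suml.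
by rewrite E; apply: eq_bigr => p _; apply: eq_bigr => q _; rewrite mulrA.
Qed.

Lemma conv_counitl f : functional f -> conv (counit U) f =1 f.
Proof.
move=> lf a; rewrite -[in RHS](counitl a) /conv.
elim: (comul a) => [|p s IH]; first by rewrite !big_nil functional0.
by rewrite !big_cons lf IH.
Qed.

Lemma conv_counitr f : functional f -> conv f (counit U) =1 f.
Proof.
move=> lf a; rewrite -[in RHS](counitr a) /conv.
elim: (comul a) => [|p s IH]; first by rewrite !big_nil functional0.
by rewrite !big_cons lf IH mulrC.
Qed.

Lemma convn_functional f n : functional f -> functional (convn f n).
Proof.
by move=> lf; elim: n => [|n IH]; [exact: functional_counit|exact: conv_functional].
Qed.

Lemma convnS f n : convn f n.+1 = conv f (convn f n).
Proof. by []. Qed.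

Lemma convnD f m n : functional f -> convn f (m + n) =1 conv (convn f m) (convn f n).
Proof.
move=> lf; elim: m => [|m IH] a.
  by rewrite conv_counitl//; exact: convn_functional.
rewrite addSn !convnS -convA//; try exact: convn_functional.
by apply: eq_bigr => p _; rewrite IH.
Qed.

(** [f 1 = 0] kills the term 1 (x) [a], so each convolution factor lowers the order by one. *)
Lemma convn_nilp f n m a : functional f -> f 1 = 0 -> nilp n a -> (n <= m)%N ->
  convn f m a = 0.
Proof.
move=> lf f1; elim: n m a => [|n IH] m a.
  by move=> -> _; exact/functional0/convn_functional.
move=> [s aE sn]; case: m => // m; rewrite ltnS => nm.
rewrite convnS /conv (aE _ _ (bilin_functionals lf (convn_functional m lf))).
rewrite big_cons /= f1 mul0r add0r.
by rewrite big_seq big1// => p /sn/IH pE; rewrite pE// mulr0.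
Qed.

Fixpoint point_pow x n : points U :=
  if n is m.+1 then pmul x (point_pow x m) else counit U.

Lemma point_powE x n : point_pow x n =1 convn x n.
Proof.
elim: n => [//|n IH] a /=; apply: eq_bigr => p _.
by rewrite [X in _ * X]IH.
Qed.

Lemma convn_pointM x n a b : convn x n (a * b) = convn x n a * convn x n b.
Proof. by rewrite -!point_powE rmorphM. Qed.

Lemma point_ext x y : x =1 y -> x = y.
Proof.
case: x => [x cx]; case: y => [y cy] /= /funext xy; subst y.
congr (GRing.LRMorphism.Pack _).
case: cx => [[a1] [a2] [a3]]; case: cy => [[b1] [b2] [b3]].
by congr GRing.LRMorphism.Class; congr (_ _); exact: Prop_irrelevance.
Qed.

Definition point_minus_counit x : U -> k := fun a => x a - counit U a.

Lemma point_minus_counit_functional x : functional (point_minus_counit x).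
Proof.
move=> c a b; rewrite /point_minus_counit functional_point functional_counit mulrBr.
by rewrite opprD addrACA.
Qed.

Lemma point_minus_counit1 x : point_minus_counit x 1 = 0.
Proof. by rewrite /point_minus_counit !rmorph1 subrr. Qed.

(** Binomial expansion of x = counit + (x - counit), the counit being the convolution unit. Terms
    with l > n are zero, so the range may be any N > n. *)
Lemma convn_binomial x n N a : (n < N)%N ->
  convn x n a = \sum_(l < N) 'C(n, l)%:R * convn (point_minus_counit x) l a.
Proof.
have lm := point_minus_counit_functional x.
elim: n N a => [|n IH] [//|N] a nN.
  rewrite big_ord_recl bin0 mul1r big1 ?addr0// => l _.
  by rewrite bin0n mul0r.
transitivity (\sum_(l < N) 'C(n, l)%:R * convn (point_minus_counit x) l.+1 a +
              \sum_(l < N) 'C(n, l)%:R * convn (point_minus_counit x) l a).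
  rewrite -big_split /=.
  transitivity (\sum_(p <- comul a) (x p.1 : k) *
      \sum_(l < N) 'C(n, l)%:R * convn (point_minus_counit x) l p.2).
    by apply: eq_bigr => p _; rewrite -(IH N).
  under [LHS]eq_bigr do rewrite mulr_sumr.
  rewrite exchange_big; apply: eq_bigr => l _ /=.
  rewrite -mulrDr -[X in _ + X]conv_counitl; last exact: convn_functional.
  rewrite /= /conv -big_split mulr_sumr; apply: eq_bigr => p _ /=.
  by rewrite mulrCA -mulrDl /point_minus_counit subrK.
rewrite [RHS]big_ord_recl.
under [X in _ = _ + X]eq_bigr do rewrite binS natrD mulrDl.
rewrite big_split [X in _ = _ + X]/= addrA [LHS]addrC; congr (_ + _).
transitivity (\sum_(l < N.+1) 'C(n, l)%:R * convn (point_minus_counit x) l a).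
  by rewrite big_ord_recr /= bin_small// mul0r addr0.
by rewrite big_ord_recl !bin0.
Qed.

End ConvolutionAlgebra.

(** * Polynomials determined by their values at the naturals *)

Section PolynomialsOverNaturals.
Variables (k : fieldType) (char0_k : ([pchar k]%R =i pred0)%type).

Lemma natr_neq0 n : (n.+1%:R : k) != 0.
Proof. by have /pcharf0P -> := char0_k. Qed.

Lemma fact_neq0 n : (n`!%:R : k) != 0.
Proof. by rewrite -(prednK (fact_gt0 n)) natr_neq0. Qed.

Lemma poly_eq_nat (p q : {poly k}) :
  (forall n : nat, p.[n%:R] = q.[n%:R]) -> p = q.
Proof.
move=> pq; apply/eqP; rewrite -subr_eq0; apply/eqP.
apply: (@roots_geq_poly_eq0 _ _ [seq n%:R | n <- iota 0 (size (p - q))]).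
- by apply/allP => _ /mapP[n _ ->]; rewrite rootE hornerD hornerN pq subrr.
- rewrite map_inj_uniq ?iota_uniq// => m n mn.
  wlog le_mn : m n mn / (m <= n)%N.
    by move=> H; have [/H->//|/ltnW/H->] := leqP m n.
  apply/eqP; rewrite eqn_leq le_mn -subn_eq0 /=.
  by have /pcharf0P <- := char0_k; rewrite natrB// mn subrr.
- by rewrite size_map size_iota.
Qed.

(** The binomial coefficient X choose l as a polynomial in X. *)
Definition binp (l : nat) : {poly k} :=
  (l`!%:R)^-1 *: \prod_(i < l) ('X - (i%:R)%:P).

Lemma binpE l n : (binp l).[n%:R] = 'C(n, l)%:R.
Proof.
rewrite /binp hornerZ horner_prod.
under eq_bigr do rewrite hornerXsubC.
have [nl|ln] := ltnP n l.
  by rewrite bin_small// (bigD1 (Ordinal nl)) //= subrr mul0r mulr0.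
apply: (mulIf (fact_neq0 l)); rewrite mulrAC mulVf ?fact_neq0// mul1r.
rewrite -natrM bin_ffact ffact_prod natr_prod; apply: eq_bigr => i _.
by rewrite natrB// (leq_trans _ ln)// ltnW.
Qed.

Lemma coef1_comp_XaddC (p : {poly k}) c : (p \Po ('X + c%:P))`_1 = p^`().[c].
Proof.
have -> : (p \Po ('X + c%:P))`_1 = (p \Po ('X + c%:P))^`().[0].
  by rewrite horner_coef0 coef_deriv.
rewrite deriv_comp derivD derivX derivC addr0 mulr1.
by rewrite horner_comp hornerD hornerX hornerC add0r.
Qed.

End PolynomialsOverNaturals.

(** * Logarithm and exponential *)

Section Logarithm.
Variables (k : fieldType) (char0_k : ([pchar k]%R =i pred0)%type).
Variables (U : affine_group k) (conilU : conilpotent U).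

Lemma convn_pow_poly (x : points U) N (a : U) n : nilp N a ->
  convn x n a =
  (\sum_(l < N) convn (point_minus_counit x) l a *: binp k l).[n%:R].
Proof.
(* This range exceeds [n] and splits at [N], beyond which the convolution powers vanish on [a]. *)
move=> aN; rewrite (@convn_binomial _ _ x n (N + n.+1)); last by rewrite addnS ltnS leq_addl.
rewrite big_split_ord /= [X in _ + X]big1 ?addr0 => [|l _]; last first.
  rewrite (convn_nilp (point_minus_counit_functional x) (point_minus_counit1 x) aN) ?mulr0//.
  exact: leq_addr.
rewrite horner_sum; apply: eq_bigr => l _.
by rewrite hornerZ binpE// mulrC.
Qed.

(* The polynomial [p a] interpolates [t |-> x^t (a)]; [log x] is its
   derivative at [t = 0]. *)
Lemma exists_log (x : points U) : exists D : U -> k,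
  [/\ Lie D, is_exp D x & forall N a, nilp N a ->
    D a = \sum_(l < N) (binp k l)`_1 * convn (point_minus_counit x) l a].
Proof.
have : forall a : U, exists p : {poly k}, forall n : nat, p.[n%:R] = convn x n a.
  move=> a; have [N aN] := conilU a.
  by eexists => n; rewrite (convn_pow_poly x n aN).
move=> /choice[p pE].
have p_uniq a q : (forall n : nat, q.[n%:R] = convn x n a) -> p a = q.
  by move=> qE; apply: (poly_eq_nat char0_k) => n; rewrite pE qE.
have fx n := convn_functional n (functional_point x).
have p_lin c a b : p (c *: a + b) = c *: p a + p b.
  by apply: p_uniq => n; rewrite hornerD hornerZ !pE fx.
have pM a b : p (a * b) = p a * p b.
  by apply: p_uniq => n; rewrite hornerM !pE convn_pointM.
have p0 a : (p a)`_0 = counit U a.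
  by rewrite -horner_coef0 (pE a 0).
pose D a := (p a)`_1.
have lD : functional D.
  by move=> c a b; rewrite /D p_lin coefD coefZ.
(* From x^(t+n) = x^t x^n: expand at t = 0 and compare the coefficients of t, for each natural n. *)
have derivp a : (p a)^`() = \sum_(q <- comul a) D q.1 *: p q.2.
  apply: (poly_eq_nat char0_k) => n; rewrite -coef1_comp_XaddC.
  have -> : p a \Po ('X + n%:R%:P) = \sum_(q <- comul a) convn x n q.2 *: p q.1.
    apply: (poly_eq_nat char0_k) => m.
    rewrite horner_comp hornerD hornerX hornerC -natrD pE convnD; last exact: functional_point.
    rewrite horner_sum; apply: eq_bigr => q _.
    by rewrite hornerZ pE mulrC.
  rewrite coef_sum horner_sum; apply: eq_bigr => q _.
  by rewrite coefZ hornerZ pE mulrC.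
have derivnp n a : ((p a)^`(n)).[0] = convn D n a.
  elim: n a => [|n IH] a; first by rewrite derivn0 horner_coef0 p0.
  rewrite derivSn derivp linear_sum horner_sum convnS; apply: eq_bigr => q _.
  by rewrite linearZ hornerZ IH.
have coefp n a : (p a)`_n = (n`!%:R)^-1 * convn D n a.
  rewrite -derivnp horner_coef0 coef_derivn addn0 ffactnn.
  by rewrite -[(p a)`_n *+ _]mulr_natl mulKf// fact_neq0.
exists D; split.
- split=> // a b; rewrite /D pM coefM big_ord_recl big_ord1 /= !p0.
  by congr (_ + _); rewrite mulrC.
- move=> a; exists (size (p a)); split=> [n an|].
    apply: (mulfI (invr_neq0 (fact_neq0 char0_k n))).
    by rewrite -coefp mulr0 nth_default.
  have -> : x a = (p a).[1%:R] by rewrite pE convnS conv_counitr//; exact: functional_point.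
  rewrite horner_coef; apply: eq_bigr => n _.
  by rewrite expr1n mulr1 coefp.
(* Here [N] depends on [a] but not on [x]; hence the formula is polynomial in the values of [x],
   which later makes the logarithm continuous. *)
- move=> N a aN; rewrite /D (p_uniq a _ (fun n => esym (convn_pow_poly x n aN))).
  by rewrite coef_sum; apply: eq_bigr => l _; rewrite coefZ mulrC.
Qed.

Lemma Lie1 (D : U -> k) : Lie D -> D 1 = 0.
Proof.
move=> [_ DM]; have /eqP := DM 1 1.
by rewrite mulr1 rmorph1 !mul1r -subr_eq0 opprD addrA subrr add0r oppr_eq0 => /eqP.
Qed.

(* The exponential is [p a] at 1 for [p a = \sum_n D^n(a) / n! 'X^n]; that [p]
   is multiplicative follows coefficientwise from
   [(p a)' = \sum D(a_1) p(a_2)]. *)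
Lemma exists_exp (D : U -> k) : Lie D -> exists x : points U,
  is_exp D x /\ forall N a, nilp N a -> x a = \sum_(n < N) (n`!%:R)^-1 * convn D n a.
Proof.
move=> LD; have [lD DM] := LD; have D1 := Lie1 LD.
have /choice[N aN] := conilU.
have lDn n := convn_functional n lD.
pose p a := \poly_(n < N a) ((n`!%:R)^-1 * convn D n a).
have pE a n : (p a)`_n = (n`!%:R)^-1 * convn D n a.
  rewrite coef_poly; case: ltnP => // Nn.
  by rewrite (convn_nilp lD D1 (aN a) Nn) mulr0.
have derivp a : (p a)^`() = \sum_(q <- comul a) D q.1 *: p q.2.
  apply/polyP => n; rewrite coef_deriv coef_sum.
  transitivity ((n`!%:R)^-1 * convn D n.+1 a).
    rewrite pE -[LHS]mulr_natl mulrA; congr (_ * _).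
    by rewrite factS natrM invfM mulrA mulfV ?mul1r// natr_neq0.
  rewrite convnS mulr_sumr; apply: eq_bigr => q _.
  by rewrite coefZ pE mulrCA.
have p_lin c a b : p (c *: a + b) = c *: p a + p b.
  by apply/polyP => n; rewrite coefD coefZ !pE lDn mulrDr mulrCA.
have p_counit a : p a = \sum_(q <- comul a) (counit U q.1 : k) *: p q.2.
  have [P PE] := @bundle_linear _ U {poly k} p p_lin.
  rewrite -{1}(counitl a) -PE linear_sum; apply: eq_bigr => q _.
  by rewrite linearZ /= PE.
have pM a b : p (a * b) = p a * p b.
  apply/polyP => n; elim: n a b => [|n IH] a b.
    rewrite coef0M !pE fact0 invr1 !mul1r -[convn D 0]/(counit U : U -> k).
    exact: rmorphM.
  apply: (mulfI (natr_neq0 char0_k n)); rewrite !mulr_natl -!coef_deriv derivp derivM.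
  have lpn : functional (fun v => (p v)`_n) by move=> c u v; rewrite p_lin coefD coefZ.
  rewrite coef_sum.
  transitivity (\sum_(q <- comul (a * b)) D q.1 * (p q.2)`_n).
    by apply: eq_bigr => q _; rewrite coefZ.
  (* The derivation rule splits D on a product into two terms with a counit factor; they match the
     two terms of the Leibniz rule once [p a] and [p b] are expanded by [p_counit]. *)
  rewrite (comulM a b (bilin_functionals lD lpn)) big_allpairs_dep /=.
  rewrite !derivp (p_counit a) (p_counit b) !big_distrlr -big_split coef_sum.
  apply: eq_bigr => q _ /=; rewrite -big_split coef_sum; apply: eq_bigr => r _ /=.
  rewrite DM IH coefD -!scalerAl -!scalerAr !scalerA !coefZ -mulrDl.
  by congr (_ * _); rewrite addrC mulrC.
have eN a M : nilp M a -> (p a).[1] = \sum_(n < M) (n`!%:R)^-1 * convn D n a.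
  move=> aM; rewrite (@horner_coef_wide _ (N a + M)); last first.
    by rewrite (leq_trans (size_poly _ _))// leq_addr.
  rewrite addnC big_split_ord /= [X in _ + X]big1 ?addr0 => [|n _]; last first.
    by rewrite pE (convn_nilp lD D1 aM) ?mulr0 ?mul0r// leq_addr.
  by apply: eq_bigr => n _; rewrite expr1n mulr1 pE.
have [||x xE] := @bundle_lrmorphism k U k^o (fun a => (p a).[1]).
- by move=> c a b; rewrite p_lin hornerD hornerZ.
- split=> [|a b]; last by rewrite pM hornerM.
  by rewrite (eN _ _ (nilp1 U)) big_ord1 fact0 invr1 mul1r -[convn D 0]/(counit U : U -> k) rmorph1.
exists x; split=> [a|M a aM]; last by rewrite xE (eN _ _ aM).
exists (N a); split; last by rewrite xE (eN _ _ (aN a)).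
by move=> n; exact: convn_nilp (aN a).
Qed.

Lemma is_exp_inj (D : U -> k) (x y : points U) : is_exp D x -> is_exp D y -> x = y.
Proof.
move=> Dx Dy; apply: point_ext => a.
have [N [DN ->]] := Dx a; have [M [DM ->]] := Dy a.
wlog NM : N M DN DM / (N <= M)%N.
  by move=> H; have [/H->//|/ltnW/H->] := leqP N M.
rewrite -(subnKC NM) big_split_ord /= [X in _ = _ + X]big1 ?addr0// => n _.
by rewrite DN ?mulr0// leq_addr.
Qed.

End Logarithm.

(** * Linear coordinates on the Lie algebra *)

Section LieAlgebra.
Variables (k : fieldType) (U : affine_group k).
Implicit Types D : U -> k.

Lemma Lie_eq_generators (s : seq U) D D' :
  generates_algebra [set` s] -> Lie D -> Lie D' ->
  (forall x, x \in s -> D x = D' x) -> D = D'.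
Proof.
move=> gens [lD DM] [lD' DM'] DD'; apply/funext.
apply: (generates_algebra_ind gens) => //.
split=> [|c a b /= Da Db|a b /= Da Db].
- by rewrite /= (Lie1 (conj lD DM)) (Lie1 (conj lD' DM')).
- by rewrite lD lD' Da Db.
- by rewrite DM DM' Da Db.
Qed.

Lemma Lie_sum r (v : 'rV[k]_r) (D : 'I_r -> U -> k) :
  (forall i, Lie (D i)) -> Lie (fun a => \sum_i v 0 i * D i a).
Proof.
move=> LD; split=> [c a b|a b].
  rewrite mulr_sumr -big_split; apply: eq_bigr => i _ /=.
  by have [-> _] := LD i; rewrite mulrDr mulrCA.
rewrite !mulr_sumr -big_split; apply: eq_bigr => i _ /=.
have [_ ->] := LD i.
by rewrite mulrDr; congr (_ + _); rewrite mulrCA.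
Qed.

(** A derivation is determined by its values on the [n] generators, so the Lie algebra embeds in
    k^n; an independent family of maximal size is a basis. *)
Lemma exists_Lie_iso : algebraic U ->
  exists (r : nat) (phi : 'rV[k]_r -> U -> k), Lie_iso phi.
Proof.
move=> [s gens]; set n := size s.
pose val_mx r (D : 'I_r -> U -> k) := \matrix_(i < r, j < n) D i (tnth (in_tuple s) j).
pose free_family r := exists D : 'I_r -> U -> k,
  (forall i, Lie (D i)) /\ row_free (val_mx r D).
have [r [free_r max_r]] : exists r, free_family r /\ forall r', free_family r' -> (r' <= r)%N.
  have free0 : exists r, `[< free_family r >].
    exists 0; apply/asboolP; exists (fun _ _ => 0); split=> [[]//|].
    by rewrite /row_free flatmx0 mxrank0.
  have free_le r : `[< free_family r >] -> (r <= n)%N.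
    by move=> /asboolP[D [_ /eqP <-]]; exact: rank_leq_col.
  by case: (ex_maxnP free0 free_le) => r /asboolP fr mr; exists r; split=> // r' /asboolP/mr.
have [D [LD freeD]] := free_r.
pose phi (v : 'rV[k]_r) (a : U) := \sum_i v 0 i * D i a.
have phiE v : \row_j phi v (tnth (in_tuple s) j) = v *m val_mx r D.
  by apply/rowP => j; rewrite !mxE; apply: eq_bigr => i _; rewrite mxE.
have phi_lin c v w a : phi (c *: v + w) a = c * phi v a + phi w a.
  rewrite mulr_sumr -big_split; apply: eq_bigr => i _ /=.
  by rewrite !mxE mulrDl mulrA.
exists r, phi; split=> //; split.
- by move=> v _; exact: Lie_sum.
- move=> v w _ _ vw; apply: (row_free_inj freeD).
  by rewrite -!phiE vw.
- move=> E LE.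
  pose e := \row_j E (tnth (in_tuple s) j).
  have [/submxP[v vE]|eD] := boolP (e <= val_mx r D)%MS.
    exists v => //; apply: (Lie_eq_generators gens (Lie_sum v LD) LE) => x xs.
    have /tnthP[j ->] : x \in in_tuple s by [].
    by have := congr1 (fun w : 'rV_n => w 0 j) (phiE v); rewrite -vE !mxE.
  suff /max_r : free_family r.+1 by rewrite ltnn.
  pose D' (i : 'I_(1 + r)) := match fintype.split i with inl _ => E | inr j => D j end.
  exists D'; split.
    by move=> i; rewrite /D'; case: fintype.split.
  have -> : val_mx (1 + r)%N D' = col_mx e (val_mx r D).
    by apply/matrixP => i j; rewrite !mxE /D'; case: fintype.split => l; rewrite mxE.
  rewrite /row_free eqn_leq rank_leq_row /=.
  apply: (@leq_trans (\rank (e + val_mx r D)%MS)); last by rewrite addsmxE.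
  move/eqP: freeD => rD; rewrite -[X in (X < _)%N]rD; apply: rank_ltmx.
  by rewrite ltmxE addsmxSr addsmx_sub (negPf eD).
Qed.

(** Finitely many evaluations suffice to separate derivations: while the rank is below [r], some
    nonzero [w] is killed by all of them, and a function [b] with [phi w b] nonzero raises the rank.
    [C] is then a right inverse of the evaluation matrix. *)
Lemma Lie_iso_coordinates r (phi : 'rV[k]_r -> U -> k) : Lie_iso phi ->
  exists m (a : 'I_m -> U) (C : 'M[k]_(m, r)),
    forall v, v = (\row_j phi v (a j)) *m C.
Proof.
move=> [phi_lin [_ phi_inj _]].
have phi0 a : phi 0 a = 0.
  by have := phi_lin (- 1) 0 0 a; rewrite scaler0 addr0 mulN1r addNr.
pose ev m (a : 'I_m -> U) := \matrix_(i < r, j < m) phi (delta_mx 0 i) (a j).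
have evE m (a : 'I_m -> U) v : v *m ev m a = \row_j phi v (a j).
  apply/rowP => j; rewrite !mxE {2}(row_sum_delta v).
  transitivity (\sum_i v 0 i * phi (delta_mx 0 i) (a j)).
    by apply: eq_bigr => i _; rewrite mxE.
  elim: (index_enum _) => [|i s IH]; first by rewrite !big_nil phi0.
  by rewrite !big_cons phi_lin IH.
have [m [a]] : exists m (a : 'I_m -> U), (r <= \rank (ev m a))%N.
  suff H d : (d <= r)%N -> exists m (a : 'I_m -> U), (d <= \rank (ev m a))%N.
    exact: (H r (leqnn r)).
  elim: d => [|d IH] dr; first by exists 0, (fun=> 0).
  have [m [a da]] := IH (ltnW dr).
  have [lt_d|] := ltnP d (\rank (ev m a)); first by exists m, a.
  move=> le_d; have : ~~ row_free (ev m a).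
    by rewrite /row_free neq_ltn (leq_ltn_trans le_d dr).
  rewrite -kermx_eq0 => /rowV0Pn[w /sub_kermxP wa w0].
  have [b wb] : exists b, phi w b <> 0.
    apply: contrapT => nb; move/eqP: w0; apply.
    apply: phi_inj; rewrite ?inE//; apply/funext => b; rewrite phi0.
    by apply: contrapT => wb; apply: nb; exists b.
  pose a' (i : 'I_(m + 1)) := match fintype.split i with inl j => a j | inr _ => b end.
  exists (m + 1)%N, a'.
  have ev'E : ev (m + 1)%N a' = row_mx (ev m a) (\col_i phi (delta_mx 0 i) b).
    by apply/matrixP => i j; rewrite !mxE /a'; case: fintype.split => l; rewrite mxE.
  (* The kernel shrinks strictly because it loses [w], so the rank grows. *)
  have ker_sub : (kermx (ev (m + 1)%N a') < kermx (ev m a))%MS.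
    rewrite ltmxE; apply/andP; split.
      apply/sub_kermxP; have := mulmx_ker (ev (m + 1)%N a').
      by rewrite ev'E mul_mx_row => /(congr1 lsubmx); rewrite row_mxKl linear0.
    apply/negP => sub; have /sub_kermxP : (w <= kermx (ev (m + 1)%N a'))%MS.
      by apply: submx_trans sub; apply/sub_kermxP.
    rewrite evE => /rowP/(_ (rshift m ord0)); rewrite !mxE /a'.
    by rewrite -[rshift m ord0]/(unsplit (inr ord0)) unsplitK.
  move/rank_ltmx: ker_sub; rewrite !mxrank_ker => lt_rank.
  apply: leq_ltn_trans da _; rewrite ltnNge; apply: contraL lt_rank => le_rank.
  by rewrite -leqNgt leq_sub2l.
move=> le_r; exists m, a, (pinvmx (ev m a)) => v.
rewrite -evE -mulmxA mulmxVp ?mulmx1//.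
by rewrite /row_free eqn_leq rank_leq_row.
Qed.

End LieAlgebra.

(** * Continuity of polynomial maps over a topological field *)

Section TopologicalFieldContinuity.
Variables (k : topologicalFieldType) (T : topologicalType).
Implicit Types f g : T -> k.

Lemma tfield_continuousD f g :
  continuous f -> continuous g -> continuous (fun t => f t + g t).
Proof.
move=> cf cg t; apply: (@continuous2_cvg _ _ _ _ _ _ f g +%R).
- exact: (@add_continuous k (f t, g t)).
- exact: cf.
- exact: cg.
Qed.

Lemma tfield_continuousM f g :
  continuous f -> continuous g -> continuous (fun t => f t * g t).
Proof.
move=> cf cg t; apply: (@continuous2_cvg _ _ _ _ _ _ f g *%R).
- exact: (@tfield_mul_continuous k (f t, g t)).
- exact: cf.
- exact: cg.
Qed.

Lemma tfield_continuous_sum (I : Type) (r : seq I) (F : I -> T -> k) :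
  (forall i, continuous (F i)) -> continuous (fun t => \sum_(i <- r) F i t).
Proof.
move=> cF; elim: r => [|i r IH].
  by under [fun _ => _]eq_fun do rewrite big_nil; exact: cst_continuous.
by under [fun _ => _]eq_fun do rewrite big_cons; exact: tfield_continuousD.
Qed.

Lemma row_continuous r (f : T -> 'rV[k]_r) :
  (forall i, continuous (fun t => f t 0 i)) -> continuous f.
Proof.
move=> cf t A [P Pt PA].
have : \forall s \near t, forall i, P 0 i (f s 0 i).
  by apply: filter_forall => i; exact: (cf i t _ (Pt 0 i)).
apply: filterS => s Ps; apply: PA => i j; rewrite (ord1 i); exact: Ps.
Qed.

End TopologicalFieldContinuity.

Lemma coord_row_continuous (k : topologicalFieldType) r (i : 'I_r) :
  continuous (fun v : 'rV[k]_r => v 0 i).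
Proof.
move=> v A Av; exists (fun _ j => if j == i then A else setT).
  by move=> x y; case: eqP => [->|_]; rewrite ?(ord1 x) //; exact: filterT.
by move=> w /(_ 0 i) /=; rewrite eqxx.
Qed.

(** * The topology of U(k) is given by evaluations *)

Section UnipotentTopology.
Variables (k : topologicalFieldType) (char0_k : ([pchar k]%R =i pred0)%type).

Lemma Lie_iso_continuous (U : affine_group k) r (phi : 'rV[k]_r -> U -> k) a :
  Lie_iso phi -> continuous (fun v => phi v a).
Proof.
move=> [phi_lin _].
have phi0 : phi 0 a = 0.
  by have := phi_lin (- 1) 0 0 a; rewrite scaler0 addr0 mulN1r addNr.
have -> : (fun v => phi v a) = (fun v : 'rV[k]_r => \sum_i v 0 i * phi (delta_mx 0 i) a).
  apply/funext => v; rewrite {1}(row_sum_delta v).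
  elim: (index_enum _) => [|i s IH]; first by rewrite !big_nil phi0.
  by rewrite !big_cons phi_lin IH.
apply: tfield_continuous_sum => i; apply: tfield_continuousM.
  exact: coord_row_continuous.
exact: cst_continuous.
Qed.

(** Along exp in a chart [phi], evaluation at [a] is the exponential series cut at the order of [a],
    a polynomial in the coordinates. *)
Lemma eval_unipotent_open (U : affine_group k) (a : U) (O : set k) :
  conilpotent U -> algebraic U -> open O ->
  unipotent_open [set x : points U | O (x a)].
Proof.
move=> conilU algU openO; have [r [phi phi_iso]] := exists_Lie_iso algU.
exists r, phi; split=> //.
have [N aN] := conilU a.
have LieV v : Lie (phi v) by have [_ [phiL _ _]] := phi_iso; exact: phiL.
have -> : [set v | exists2 x : points U, is_exp (phi v) x & O (x a)] =
    (fun v => \sum_(n < N) (n`!%:R)^-1 * convn (phi v) n a) @^-1` O.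
  apply/seteqP; split=> v /=; have [y [expy yE]] := exists_exp char0_k conilU (LieV v).
    by move=> [x expx]; rewrite (is_exp_inj expx expy) (yE N a aN).
  by move=> Ov; exists y => //; rewrite (yE N a aN).
have cn m b : continuous (fun v => convn (phi v) m b).
  elim: m b => [|m IH] b; first exact: cst_continuous.
  apply: tfield_continuous_sum => p; apply: tfield_continuousM; last exact: IH.
  exact: Lie_iso_continuous.
have /continuousP : continuous (fun v => \sum_(n < N) (n`!%:R)^-1 * convn (phi v) n a).
  apply: tfield_continuous_sum => n; apply: tfield_continuousM.
    exact: cst_continuous.
  exact: cn.
exact.
Qed.

(** In the chart [phi] that witnesses the openness of [W], the coordinates of log(h t) are linear in
    finitely many of its values, and those are polynomial in values of [h t]. *)
Lemma unipotent_open_continuous (U : affine_group k) (T : topologicalType)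
    (h : T -> points U) (W : set (points U)) : conilpotent U ->
  (forall a, continuous (fun t => h t a : k)) -> unipotent_open W ->
  open (h @^-1` W).
Proof.
move=> conilU ch [r [phi [phi_iso openW]]].
have [m [a [C vC]]] := Lie_iso_coordinates phi_iso.
have /choice[D DP] := fun t => exists_log char0_k conilU (h t).
have cl l b : continuous (fun t => convn (point_minus_counit (h t)) l b).
  elim: l b => [|l IH] b; first exact: cst_continuous.
  apply: tfield_continuous_sum => p; apply: tfield_continuousM; last exact: IH.
  by apply: tfield_continuousD; [exact: ch|exact: cst_continuous].
have cD b : continuous (fun t => D t b).
  have [N bN] := conilU b.
  have -> : (fun t => D t b) = (fun t =>
      \sum_(l < N) (binp k l)`_1 * convn (point_minus_counit (h t)) l b).
    by apply/funext => t; have [_ _ DE] := DP t; exact: DE.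
  apply: tfield_continuous_sum => l; apply: tfield_continuousM.
    exact: cst_continuous.
  exact: cl.
pose v t := (\row_j D t (a j)) *m C.
have vE t : phi (v t) = D t.
  have [LD _ _] := DP t; have [_ [_ _ phi_surj]] := phi_iso.
  have [w _ wD] := phi_surj _ LD.
  by rewrite /v -wD -vC.
have cv : continuous v.
  apply: row_continuous => i.
  have -> : (fun t => v t 0 i) = (fun t => \sum_j D t (a j) * C j i).
    by apply/funext => t; rewrite mxE; apply: eq_bigr => j _; rewrite mxE.
  apply: tfield_continuous_sum => j; apply: tfield_continuousM => //.
  exact: cst_continuous.
have -> : h @^-1` W = v @^-1` [set w | exists2 x : points U, is_exp (phi w) x & W x].
  apply/seteqP; split=> t /=; rewrite vE; have [_ expD _] := DP t.
    by move=> Wt; exists (h t).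
  by move=> [x expx Wx]; rewrite (is_exp_inj expD expx).
by move/continuousP: cv; exact.
Qed.

Lemma prounipotent_open_continuous (U : affine_group k) (T : topologicalType)
    (h : T -> points U) (V : set (points U)) : conilpotent U ->
  (forall a, continuous (fun t => h t a : k)) -> prounipotent_open V ->
  open (h @^-1` V).
Proof.
(* Sets with open preimage form a topology, so only the generating open sets matter. *)
move=> conilU ch; suff : @prounipotent_open k U `<=` [set V | open (h @^-1` V)] by exact.
apply: smallest_sub.
  split=> [|A B oA oB|F oF] /=.
  - by rewrite preimage_setT; exact: openT.
  - by rewrite preimage_setI; exact: openI.
  - by rewrite preimage_bigcup; exact: bigcup_open.
move=> _ [Q [f [W [injf algQ openW ->]]]] /=.
rewrite -comp_preimage; apply: unipotent_open_continuous openW => [b|b] /=.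
  have [n bn] := conilU (comorph f b); exists n; exact: nilp_injective bn.
exact: ch.
Qed.

Lemma unipotent_conilpotent (U : affine_group k) : unipotent U -> conilpotent U.
Proof. by move=> [_ [m [a]]]; exact: unitriangular_conilpotent. Qed.

Lemma prounipotent_conilpotent (U : affine_group k) : prounipotent U -> conilpotent U.
Proof.
move=> prounipU a; have [Q [f [injf algQ [b <-]]]] := exists_algebraic_quotient a.
have [n bn] := unipotent_conilpotent (prounipU Q f injf algQ) b.
by exists n; exact: nilp_comorph.
Qed.

Lemma conilpotent_prounipotent (U : affine_group k) : conilpotent U -> prounipotent U.
Proof.
move=> conilU Q f injf algQ; apply: conilpotent_unipotent => // b.
by have [n bn] := conilU (comorph f b); exists n; exact: nilp_injective bn.
Qed.

Lemma cont_hom_eval_continuous (G : topologicalGroupType) (U : affine_group k)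
    (h : cont_hom G U) (a : U) :
  prounipotent U -> continuous (fun g => h g a : k).
Proof.
move=> prounipU; apply/continuousP => O openO.
have [Q [f [injf algQ [b <-]]]] := exists_algebraic_quotient a.
have unipQ := prounipU Q f injf algQ.
apply: (@cont_hom_continuous _ _ _ h [set x | O (x (comorph f b))]).
apply: sub_gen_smallest; exists Q, f, [set x | O (x b)]; split=> //.
exact: eval_unipotent_open (unipotent_conilpotent unipQ) algQ openO.
Qed.

End UnipotentTopology.

(** * The subgroup of [G] on which a Hopf ideal vanishes *)

Section ZariskiClosure.
Variables (k : topologicalFieldType) (G : topologicalGroupType) (U : affine_group k).
Variables (u : cont_hom G U) (I : set U).
Hypothesis hopfI : hopf_ideal I.

(** [u 1] is idempotent for convolution and has the inverse [u 1 \o antipode U], so it is the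
    unit. *)
Lemma cont_hom1 : u 1%g =1 counit U.
Proof.
set e := u 1%g; have fe := functional_point e.
have ee : conv e e =1 e.
  move=> a; rewrite -[LHS]/(pmul e e a) /e -cont_homM.
  by rewrite mulg1.
have fS : functional (e \o antipode U) by move=> c a b; rewrite /= linearP fe.
have Se : conv (e \o antipode U) e =1 counit U.
  move=> a; transitivity (e (\sum_(p <- comul a) antipode U p.1 * p.2) : k).
    by rewrite linear_sum; apply: eq_bigr => p _; rewrite rmorphM.
  by rewrite antipodel linearZ rmorph1 /= [LHS]mulr1.
move=> a; rewrite -Se -[LHS]conv_counitl//.
transitivity (conv (conv (e \o antipode U) e) e a).
  by apply: eq_bigr => p _; rewrite Se.
by rewrite -convA//; apply: eq_bigr => p _; rewrite ee.
Qed.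

Lemma cont_homV g : u (g^-1)%g =1 u g \o antipode U.
Proof.
have fg := functional_point (u g); have fg' := functional_point (u (g^-1)%g).
have fS : functional (u g \o antipode U) by move=> c a b; rewrite /= linearP fg.
have gg' : conv (u (g^-1)%g) (u g) =1 counit U.
  by move=> a; rewrite -[LHS]/(pmul _ _ a) -cont_homM mulVg cont_hom1.
have gS : conv (u g) (u g \o antipode U) =1 counit U.
  move=> a; transitivity (u g (\sum_(p <- comul a) p.1 * antipode U p.2) : k).
    by rewrite linear_sum; apply: eq_bigr => p _; rewrite rmorphM.
  by rewrite antipoder linearZ rmorph1 /= [LHS]mulr1.
move=> a; rewrite -[RHS]conv_counitl// -[LHS]conv_counitr//.
transitivity (conv (u (g^-1)%g) (conv (u g) (u g \o antipode U)) a).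
  by apply: eq_bigr => p _; rewrite gS.
by rewrite convA//; apply: eq_bigr => p _; rewrite gg'.
Qed.

Lemma vanishing_subgroup : is_subgroup [set g | forall a, I a -> u g a = 0].
Proof.
have [_ Icm Ie IS] := hopfI; split=> /= [a Ia|x y Ix Iy a Ia|x Ix a Ia].
- by rewrite cont_hom1; exact: Ie.
- rewrite cont_homM -[LHS]/(conv (u x) (u y) a).
  have [s aE sI] := Icm a Ia.
  rewrite /conv (aE _ _ (bilin_functionals (functional_point _) (functional_point _))).
  by rewrite big_seq big1// => p /sI[/Ix ->|/Iy ->]; rewrite (mul0r, mulr0).
- by rewrite cont_homV; apply: Ix; exact: IS.
Qed.

End ZariskiClosure.

Lemma cont_hom_ext (k : topologicalFieldType) (G : topologicalGroupType)
    (U : affine_group k) (u v : cont_hom G U) : (forall g, u g = v g) -> u = v.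
Proof.
case: u => u uM uc; case: v => v vM vc /= /funext uv; subst v.
by congr ContHom; exact: Prop_irrelevance.
Qed.

(** Transparent, so that its comorphism reduces to the identity. *)
Definition ghom_id (k : fieldType) (U : affine_group k) : ghom U U.
Proof.
refine (@GHom k U U idfun _ _) => // b W phi bphi.
by rewrite big_map; apply: eq_bigr => p _.
Defined.

Theorem lemma1p5 (k : topologicalFieldType) (G : topologicalGroupType)
    (M : affine_group k) (hausdorff_k : hausdorff_space k)
    (char0_k : ([pchar k]%R =i pred0)%type)
    (fg_G : topologically_fg G)
    (malcev_M : malcev_completion G M) :
  prounipotent_fg M.
Proof.
have [prounipM [Phi [Phi_bij Phi_nat]]] := malcev_M.
have conilM := prounipotent_conilpotent prounipM.
(* The universal homomorphism, as in Yoneda's lemma. *)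
pose u := Phi M prounipM (ghom_id M).
have cu a : continuous (fun g => u g a : k).
  exact: cont_hom_eval_continuous.
have [s s_dense] := fg_G.
exists [set u g | g in [set` s]]; first exact/finite_image/finite_seq.
move=> I hopfI sI.
(* As [k] is Hausdorff, {0} is closed and the locus where [a] does not vanish is open. If nonempty,
   it would meet the dense subgroup, on which [a] vanishes by [vanishing_subgroup]. *)
have uI g a : I a -> u g a = 0.
  move=> Ia; apply: contrapT => uga.
  have openO : open [set g' | u g' a != 0 :> k].
    have /continuousP/(_ (~` [set 0])) := cu a.
    have -> : (fun g' => u g' a : k) @^-1` (~` [set 0]) = [set g' | u g' a != 0 :> k].
      by apply/seteqP; split=> x /= /eqP.
    apply; apply: closed_openC.
    exact/accessible_closed_set1/hausdorff_accessible.
  have [|g' [/= /eqP ug' gen_g']] := s_dense _ _ openO; first by exists g; apply/eqP.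
  apply: ug'; apply: (smallest_sub (vanishing_subgroup u hopfI) _ gen_g') => // x sx b Ib.
  by apply: sI => //; exists x.
have [H [pi [pi_surj pi_eq0]]] := hopf_quotient hopfI.
have /choice[rep repK] := pi_surj.
have pi_eq a b : comorph pi a = comorph pi b -> forall g, u g a = u g b.
  move=> ab g; apply/eqP; rewrite -subr_eq0 -linearB; apply/eqP/uI/pi_eq0.
  by rewrite rmorphB /= ab subrr.
have conilH : conilpotent H.
  move=> b; rewrite -(repK b); have [n an] := conilM (rep b).
  by exists n; exact: nilp_comorph.
have prounipH := conilpotent_prounipotent conilH.
(* [u g] kills [I], so its value on a representative depends only on the class. *)
have : forall g, exists x : points H, forall a, x (comorph pi a) = u g a.
  move=> g; have [||x xE] := @bundle_lrmorphism k H k^o (fun b => u g (rep b)).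
  - move=> c x y; rewrite -linearP; apply: pi_eq.
    by rewrite linearP /= !repK.
  - split; first by rewrite -(rmorph1 (u g)); apply: pi_eq; rewrite repK rmorph1.
    by move=> x y; rewrite -rmorphM; apply: pi_eq; rewrite rmorphM /= !repK.
  by exists x => a; rewrite xE; apply: pi_eq; rewrite repK.
move=> /choice[h hE].
have hM g g' : h (g * g')%g = pmul (h g) (h g').
  apply: point_ext => b; rewrite -(repK b) hE cont_homM.
  rewrite -[RHS]/(conv (h g) (h g') _) /conv.
  rewrite (comorph_comul pi _ (bilin_functionals (functional_point _) (functional_point _))).
  by rewrite big_map; apply: eq_bigr => p _; rewrite !hE.
have ch b : continuous (fun g => h g b : k).
  have -> : (fun g => h g b : k) = (fun g => u g (rep b)).
    by apply/funext => g; rewrite -{1}(repK b) hE.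
  exact: cu.
pose hc := ContHom hM (fun V oV => prounipotent_open_continuous char0_k conilH ch oV).
have [j jE] : exists j, Phi H prounipH j = hc.
  by have [Psi _ PhiK] := Phi_bij H prounipH; exists (Psi hc).
(* By naturality along [pi], both sides correspond to [u] under the bijection for [M]. *)
have pij : gcomp pi j = ghom_id M.
  apply: (bij_inj (Phi_bij M prounipM)); apply: cont_hom_ext => g.
  rewrite (Phi_nat _ _ prounipH prounipM pi j g) jE.
  by apply: point_ext => a; exact: hE.
apply/seteqP; split=> [a Ia|_ ->]; last by have [[]] := hopfI.
have /pi_eq0 pia := Ia; rewrite /= -[LHS]/(comorph (ghom_id M) a) -pij /=.
by rewrite pia rmorph0.
Qed.
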